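(* For every real number $\beta>1$, the two-sided $\beta$-shift $X_\beta$ has a unique $\mathfrak{T}_{X_\beta}$-invariant Borel probability measure.
   Context: For $\beta>1$ let $T_\beta:[0,1)\to[0,1)$, $T_\beta(x)=\beta x \bmod 1$. The greedy $\beta$-expansion of $x\in[0,1)$ is the sequence $(a_1,a_2,\ldots)$ with $a_k=\lfloor\beta\,T_\beta^{k-1}x\rfloor$ for $k\ge1$; it satisfies $x=\sum_{k\ge1}a_k\beta^{-k}$. The two-sided $\beta$-shift $X_\beta\subset\{0,\ldots,\lfloor\beta\rfloor\}^{\mathbb{Z}}$ is the subshift of all bi-infinite sequences all of whose finite subwords occur as blocks of consecutive digits in greedy $\beta$-expansions of numbers in $[0,1)$. The Gibbs relation $\mathfrak{T}_{X_\beta}$ is the set of pairs $(x,y)\in X_\beta\times X_\beta$ with $x_n=y_n$ for all but finitely many $n\in\mathbb{Z}$. A Borel probability measure $\mu$ on $X_\beta$ (not assumed shift-invariant) is $\mathfrak{T}_{X_\beta}$-invariant if $\mu(\gamma(A))=\mu(A)$ for every Borel isomorphism $\gamma:A\to B$ between Borel sets $A,B\subset X_\beta$ with $(x,\gamma(x))\in\mathfrak{T}_{X_\beta}$ for all $x\in A$. *)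

(* Defs.v *)
From HB Require Import structures.
From mathcomp Require Import all_boot all_order all_algebra.
From mathcomp Require Import all_classical all_reals all_analysis.

Set Implicit Arguments.
Unset Strict Implicit.
Unset Printing Implicit Defensive.

Import Order.TTheory GRing.Theory Num.Theory.

Local Open Scope classical_set_scope.
Local Open Scope ring_scope.

Definition beta_map {R : realType} (beta x : R) : R :=
  beta * x - (Num.floor (beta * x))%:~R.

(* Digits are numbered from 0: [beta_digit beta x k] is the digit a_(k+1) of   *)
(* the greedy expansion. [Num.truncn] agrees with the floor here, since        *)
(* [beta * iter k (beta_map beta) x] is nonnegative for [0 <= beta], [0 <= x]. *)
Definition beta_digit {R : realType} (beta x : R) (k : nat) : nat :=
  Num.truncn (beta * iter k (beta_map beta) x).

(* The subword of [s] of length [n] starting at [m] is a block of consecutive  *)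
(* digits of the greedy expansion of some x in [0, 1).                         *)
Definition beta_admissible {R : realType} (beta : R) (s : int -> nat)
    (m : int) (n : nat) : Prop :=
  exists2 x : R, 0 <= x < 1 &
    exists k : nat, forall i : nat, (i < n)%N ->
      s (m + i%:Z) = beta_digit beta x (k + i).

(* Bi-infinite sequences carry the product of the discrete topologies on nat;  *)
(* the alphabet {0, ..., floor beta} is the first condition.                   *)
Definition beta_shift {R : realType} (beta : R) : set {ptws int -> nat} :=
  [set s | (forall n : int, (s n <= Num.truncn beta)%N) /\
           (forall (m : int) (n : nat), beta_admissible beta s m n)].

Definition beta_shift_space {R : realType} (beta : R) : Type :=
  set_type (beta_shift beta).

HB.instance Definition _ (R : realType) (beta : R) :=
  Topological.copy (beta_shift_space beta) (set_type (beta_shift beta)).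

Lemma beta_shift_zero (R : realType) (beta : R) :
  (fun=> 0%N) \in beta_shift beta.
Proof.
rewrite inE; split=> // m n; exists 0; first by rewrite lexx ltr01.
exists 0%N => i _; rewrite /beta_digit add0n.
have -> : iter i (beta_map beta) 0 = 0.
  by elim: i => //= i ->; rewrite /beta_map mulr0 floor0 subr0.
by rewrite mulr0 truncn0.
Qed.

(* Measurable types are pointed in the library.                                *)
HB.instance Definition _ (R : realType) (beta : R) :=
  isPointed.Build (beta_shift_space beta)
    (exist _ (fun=> 0%N) (beta_shift_zero beta)).

Definition beta_shift_borel {R : realType} (beta : R) :=
  g_sigma_algebraType (@open (beta_shift_space beta)).

Definition gibbs_relation {R : realType} (beta : R)
    (x y : beta_shift_borel beta) : Prop :=
  finite_set [set n : int | set_val x n <> set_val y n].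

(* [g] is a bijection of [A] onto [B], measurable in both directions; values   *)
(* of [g] outside [A] and of its inverse [h] outside [B] are irrelevant.       *)
Definition measurable_iso {d : measure_display} {T : measurableType d}
    (A B : set T) (g : T -> T) : Prop :=
  [/\ measurable A, measurable B, set_bij A B g, measurable_fun A g &
      exists h : T -> T,
        [/\ measurable_fun B h, set_fun B A h, {in A, cancel g h} &
            {in B, cancel h g}]].

Definition gibbs_invariant {R : realType} (beta : R)
    (mu : probability (beta_shift_borel beta) R) : Prop :=
  forall (A B : set (beta_shift_borel beta))
      (g : beta_shift_borel beta -> beta_shift_borel beta),
    measurable_iso A B g -> (forall x, A x -> gibbs_relation x (g x)) ->
    mu (g @` A) = mu A.

(* Main.v *)
(** Reading digits, the interval of values still allowed for the tail of the
expansion is [[0, t)] for a state [t] in [[0, 1]]: it starts at [1] and the digit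
[a] turns [t] into [beta t - a] clamped to [[0, 1]].  A sequence lies in the
beta-shift iff every window of it keeps the state positive, and since the
clamped values of [beta t - a] add up to [beta t], there are about [t beta^n]
words of length [n] starting in state [t]; a positive fraction of them end in
state [1], where the past is forgotten.

Uniqueness.  At any position where the past could be continued by the digit [1],
continuing it by [0] leads to state [1], after which every word from [1] to [1]
fits; every point has such positions arbitrarily far to the left.  Rewriting
windows that start there bounds the mass of the cylinder of [w] between two
constant multiples of [beta^-|w| t(w)], for every Gibbs invariant probability.
Hence [mu <= K nu] for all Gibbs invariant [mu], [nu] with one constant [K > 1];
but then [(K nu - mu) / (K - 1)] is Gibbs invariant as well, and comparing [mu]
with it replaces [K - 1] by at most [(K - 1) / 2].  Iterating, [mu <= nu].

Existence.  Along the orbit [t_j] of [1] under maximal digits,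
[weight w = sum_j beta^-j t_j(w)] is, up to the factor [beta], preserved by summing
over one more digit on either side, so [beta^-|w| weight w] is, up to
normalisation, the cylinder mass of a probability.  Exchanging [u] and [v] inside
[p u q] changes the weight only if [p] or [q] never visits state [1], which happens
for so few words that the total change tends to [0] as [p] and [q] get longer. *)

Require Import Defs.
From HB Require Import structures.
From mathcomp Require Import all_boot all_order all_algebra.
From mathcomp Require Import all_classical all_reals all_analysis.
From mathcomp Require Import ring lra zify.

Set Implicit Arguments.
Unset Strict Implicit.
Unset Printing Implicit Defensive.
Import Order.TTheory GRing.Theory Num.Theory numFieldNormedType.Exports.
Local Open Scope classical_set_scope.
Local Open Scope ring_scope.

(** * Words and the digit automaton *)

Section words.
Variable M : nat.

Fixpoint words (n : nat) : seq (seq nat) :=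
  if n is n'.+1 then [seq rcons w a | w <- words n', a <- iota 0 M] else [:: [::]].

Lemma mem_words n w : (w \in words n) = (size w == n) && all (fun a => (a < M)%N) w.
Proof.
elim: n w => [|n IH] w; first by rewrite inE; case: w.
apply/allpairsP/andP => [[[u a] /= [+ + ->]]|[/eqP sw aw]].
  by rewrite IH mem_iota add0n size_rcons all_rcons => /andP[/eqP -> ->] /= ->.
case/lastP: w sw aw => // u a; rewrite size_rcons all_rcons => -[su] /andP[aM au].
by exists (u, a); split => //=; rewrite ?IH ?su ?eqxx ?mem_iota.
Qed.

Lemma size_words n w : w \in words n -> size w = n.
Proof. by rewrite mem_words => /andP[/eqP]. Qed.

Lemma uniq_words n : uniq (words n).
Proof.
elim: n => //= n IH; apply: allpairs_uniq => //; first exact: iota_uniq.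
by move=> [u a] [v b] _ _ /= /rcons_inj[-> ->].
Qed.

Lemma words_cat k n u v : u \in words k -> v \in words n -> u ++ v \in words (k + n).
Proof.
rewrite !mem_words size_cat all_cat => /andP[/eqP -> ->] /andP[/eqP -> ->].
by rewrite eqxx.
Qed.

Variable V : nmodType.

Lemma sum_wordsS n (f : seq nat -> V) :
  \sum_(w <- words n.+1) f w = \sum_(w <- words n) \sum_(a < M) f (rcons w a).
Proof.
rewrite /= big_allpairs_dep; apply: eq_bigr => w _.
by rewrite -(big_mkord xpredT (fun a => f (rcons w a))) /index_iota subn0.
Qed.

Lemma sum_words_cat k n (f : seq nat -> V) :
  \sum_(w <- words (k + n)) f w =
  \sum_(u <- words k) \sum_(v <- words n) f (u ++ v).
Proof.
elim: n f => [|n IH] f.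
  by rewrite addn0; apply: eq_bigr => u _; rewrite big_seq1 cats0.
rewrite addnS sum_wordsS IH; apply: eq_bigr => u _.
rewrite sum_wordsS; apply: eq_bigr => v _; apply: eq_bigr => a _.
by rewrite rcons_cat.
Qed.

Lemma sum_words1 (f : seq nat -> V) :
  \sum_(w <- words 1) f w = \sum_(a < M) f [:: val a].
Proof. by rewrite sum_wordsS big_seq1. Qed.

Lemma sum_words_cons n (f : seq nat -> V) :
  \sum_(w <- words n.+1) f w = \sum_(a < M) \sum_(w <- words n) f (val a :: w).
Proof. by rewrite -add1n sum_words_cat sum_words1. Qed.

End words.

(** * Growth of the numbers of live and of resetting words *)

Section automaton.
Variables (R : realType) (beta : R).
Hypothesis beta_gt1 : 1 < beta.

Let beta_gt0 : 0 < beta. Proof. exact: lt_trans beta_gt1. Qed.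

Local Notation M := (Num.truncn beta).+1.
Local Notation Ws := (words M).

(* State [0] is dead: [step] clamps there as soon as a digit is not allowed. *)
Definition step (t : R) (a : nat) : R := Num.max 0 (Num.min 1 (beta * t - a%:R)).
Definition state (t : R) (w : seq nat) : R := foldl step t w.

Lemma state_cat t u v : state t (u ++ v) = state (state t u) v.
Proof. exact: foldl_cat. Qed.

Lemma state_rcons t w a : state t (rcons w a) = step (state t w) a.
Proof. by rewrite -cats1 state_cat. Qed.

Lemma step_ge0 t a : 0 <= step t a. Proof. by rewrite /step le_max lexx. Qed.

Lemma step_le1 t a : step t a <= 1.
Proof. by rewrite /step ge_max ler01 ge_min lexx. Qed.

Lemma le_step t t' a : t <= t' -> step t a <= step t' a.
Proof.
by move=> tt'; rewrite /step le_max2 // le_min2 // lerD2r ler_pM2l.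
Qed.

Lemma state_ge0 t w : 0 <= t -> 0 <= state t w.
Proof. by case/lastP: w => // w a _; rewrite state_rcons step_ge0. Qed.

Lemma state_le1 t w : t <= 1 -> state t w <= 1.
Proof. by case/lastP: w => // w a _; rewrite state_rcons step_le1. Qed.

Lemma le_state t t' w : t <= t' -> state t w <= state t' w.
Proof. by elim: w t t' => //= a w IH t t' tt'; apply/IH/le_step. Qed.

Lemma step0 a : step 0 a = 0.
Proof.
rewrite /step mulr0 sub0r; apply/max_idPl.
by rewrite ge_min oppr_le0 ler0n orbT.
Qed.

Lemma state0 w : state 0 w = 0.
Proof. by elim: w => //= a w; rewrite step0. Qed.

Lemma step_gt0 t a : (0 < step t a) = (a%:R < beta * t).
Proof. by rewrite /step lt_max ltxx /= lt_min ltr01 /= subr_gt0. Qed.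

Lemma step_eq1 t a : (step t a == 1) = (a%:R + 1 <= beta * t).
Proof.
rewrite eq_le step_le1 /= /step le_max ler10 /= le_min lexx /=.
by rewrite lerBrDl.
Qed.

Lemma state_gt0_prefix t u v : 0 <= t -> 0 < state t (u ++ v) -> 0 < state t u.
Proof.
move=> t0; rewrite state_cat; apply: contraTT.
rewrite lt0r state_ge0 // andbT negbK => /eqP ->.
by rewrite state0 ltxx.
Qed.

Lemma state_gt0_suffix t u v : t <= 1 -> 0 < state t (u ++ v) -> 0 < state 1 v.
Proof.
move=> t1; rewrite state_cat => h; apply: lt_le_trans h (le_state _ _).
exact: state_le1.
Qed.

(** For [t > 0] a digit [a] is allowed iff [a < beta t], strictly, so the largest allowed digit is
    the ceiling minus one. If [beta t] is an integer, [top t] is then [1] and not [0]: [top] is the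
    quasi-greedy map. *)
Definition maxdigit (t : R) : nat := `|Num.ceil (beta * t) - 1|%N.
Definition top (t : R) : R := beta * t - (maxdigit t)%:R.

Lemma maxdigitP t : 0 < t -> (maxdigit t)%:R < beta * t <= (maxdigit t)%:R + 1.
Proof.
move=> t0; have bt0 : 0 < beta * t by rewrite mulr_gt0.
have c1 : 0 <= Num.ceil (beta * t) - 1 by rewrite subr_ge0 -gtz0_ge1 ceil_gt0.
have e : (maxdigit t)%:R = (Num.ceil (beta * t))%:~R - 1 :> R.
  by rewrite /maxdigit natr_absz ger0_norm // rmorphB.
by rewrite e subrK ceil_ge andbT ltrBlDr -ltrBlDr -[X in _ - X]/(1%:~R) -rmorphB /= ceilB1_lt.
Qed.

Lemma top_gt0 t : 0 < t -> 0 < top t.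
Proof. by move=> /maxdigitP /andP[h _]; rewrite subr_gt0. Qed.

Lemma top_le1 t : 0 < t -> top t <= 1.
Proof. by move=> /maxdigitP /andP[_]; rewrite lerBlDl. Qed.

Lemma maxdigit_lt t : 0 < t <= 1 -> (maxdigit t < M)%N.
Proof.
move=> /andP[t0 t1]; rewrite ltnS truncn_ge_nat ?ltW //.
have /andP[h _] := maxdigitP t0; apply: lt_le_trans h _; by rewrite ger_pMr.
Qed.

(** Digits below [maxdigit t] lead to [1], the digit [maxdigit t] leads to [top t], and larger ones
    to the dead state, where [f] vanishes. *)
Lemma sum_step (f : R -> R) t : f 0 = 0 -> 0 < t <= 1 ->
  \sum_(a < M) f (step t a) = (maxdigit t)%:R * f 1 + f (top t).
Proof.
move=> f0 t01; have cM := maxdigit_lt t01; have /andP[t0 t1] := t01.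
have /andP[h1 h2] := maxdigitP t0.
rewrite -(big_mkord xpredT (fun a => f (step t a))).
rewrite (@big_cat_nat _ _ _ (maxdigit t)) //=; last exact: ltnW.
congr (_ + _).
  rewrite (eq_big_nat _ _ (F2 := fun=> f 1)).
    by rewrite big_const_nat subn0 iter_addr_0 mulr_natl.
  move=> a /andP[_ ac]; congr f; apply/eqP; rewrite step_eq1.
  by apply: le_trans (ltW h1); rewrite natr1 ler_nat.
rewrite big_ltn // big_nat big1 ?addr0.
  congr f; rewrite /step /top.
  have -> : Num.min 1 (beta * t - (maxdigit t)%:R) = top t.
    by apply/min_idPr/top_le1.
  by apply/max_idPr/ltW/top_gt0.
move=> a /andP[ca _]; rewrite (_ : step t a = 0) //; apply/eqP.
rewrite eq_le step_ge0 andbT leNgt step_gt0 -leNgt.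
by apply: le_trans h2 _; rewrite natr1 ler_nat.
Qed.

Lemma sum_step_id t : 0 <= t <= 1 -> \sum_(a < M) step t a = beta * t.
Proof.
move=> /andP[]; rewrite le_eqVlt => /orP[/eqP <- _|t0 t1].
  by rewrite mulr0 big1 // => a _; rewrite step0.
by rewrite (@sum_step id) ?t0 // mulr1 addrC subrK.
Qed.

Lemma sum_state n t : 0 <= t <= 1 -> \sum_(w <- Ws n) state t w = beta ^+ n * t.
Proof.
move=> /andP[t0 t1]; elim: n => [|n IH]; first by rewrite big_seq1 mul1r.
rewrite sum_wordsS exprS -mulrA -IH mulr_sumr; apply: eq_bigr => w _.
rewrite -sum_step_id ?state_ge0 ?state_le1 //.
by apply: eq_bigr => a _; rewrite state_rcons.
Qed.

Definition nreset n t : R := \sum_(w <- Ws n) (state t w == 1)%:R.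
Definition nadm n t : R := \sum_(w <- Ws n) (0 < state t w)%R%:R.

Lemma nreset_ge0 n t : 0 <= nreset n t.
Proof. by apply: sumr_ge0 => w _; rewrite ler0n. Qed.

Lemma nadm_ge0 n t : 0 <= nadm n t.
Proof. by apply: sumr_ge0 => w _; rewrite ler0n. Qed.

Lemma nreset_le n t : 0 <= t <= 1 -> nreset n t <= beta ^+ n * t.
Proof.
move=> t01; rewrite -sum_state //; apply: ler_sum => w _.
have [->//|_] := eqVneq; apply: state_ge0; by case/andP: t01.
Qed.

Lemma nadm_ge n t : 0 <= t <= 1 -> beta ^+ n * t <= nadm n t.
Proof.
move=> t01; rewrite -sum_state //; apply: ler_sum => w _.
have /andP[t0 t1] := t01.
have [h|h] := ltP; first exact: state_le1.
exact: h.
Qed.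

(** The digit [0] keeps the state at [1]. *)
Lemma nresetS n t : 0 <= t <= 1 -> nreset n t <= nreset n.+1 t.
Proof.
move=> /andP[t0 t1]; rewrite /nreset sum_wordsS; apply: ler_sum => w _.
rewrite big_ord_recl /= state_rcons step_eq1 add0r.
have [->|_] := eqVneq.
  by rewrite mulr1 (ltW beta_gt1) lerDl sumr_ge0.
by rewrite addr_ge0 // sumr_ge0.
Qed.

(** From a live state only one allowed digit, the maximal one, may fail to reset; so there are at
    most as many non-resetting live words of length [n.+1] as live words of length [n]. *)
Lemma nadmS n t : 0 <= t <= 1 -> nadm n.+1 t <= nreset n.+1 t + nadm n t.
Proof.
move=> /andP[t0 t1]; rewrite /nreset /nadm !sum_wordsS -big_split /=.
apply: ler_sum => w _.
have [s0|s0] := ltP 0 (state t w); last first.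
  have e0 : state t w = 0 by apply: le_anti; rewrite s0 state_ge0.
  rewrite addr0.
  by apply: ler_sum => a _; rewrite state_rcons e0 step0 ltxx.
have s01 : 0 < state t w <= 1 by rewrite s0 state_le1.
under eq_bigr do rewrite state_rcons.
under [X in _ <= X + _]eq_bigr do rewrite state_rcons.
rewrite (@sum_step (fun x => (0 < x)%R%:R)) ?ltxx // (@sum_step (fun x => (x == 1)%:R)) //.
  by rewrite ltr01 eqxx !mulr1 top_gt0 //= lerD2r lerDl.
by rewrite eq_sym oner_eq0.
Qed.

Lemma nadm_add n J t : 0 <= t <= 1 ->
  nadm (J + n) t <= J%:R * nreset (J + n) t + nadm n t.
Proof.
move=> t01; elim: J => [|J IH]; first by rewrite mul0r add0r.
rewrite addSn; apply: le_trans (nadmS _ t01) _.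
rewrite -natr1 mulrDl mul1r addrAC [leRHS]addrC lerD2l.
apply: le_trans IH _; rewrite lerD2r ler_wpM2l //; exact: nresetS.
Qed.

(** The constant solves [C = 1 + C / beta], which closes the induction over [nadmS] and [nreset_le];
    the summand [1] pays for the empty word. *)
Lemma nadm_le n t : 0 <= t <= 1 ->
  nadm n t <= beta / (beta - 1) * (beta ^+ n * t) + 1.
Proof.
move=> t01; have /andP[t0 t1] := t01; elim: n => [|n IH].
  rewrite /nadm big_seq1 /= expr0 mul1r.
  have ? : 0 <= beta / (beta - 1) * t.
    by rewrite mulr_ge0 // divr_ge0 ?subr_ge0 // ltW.
  by case: (0 < t)%R => /=; lra.
apply: le_trans (nadmS _ t01) _.
apply: le_trans (lerD (nreset_le _ t01) IH) _.
rewrite addrA lerD2r exprS le_eqVlt; apply/orP; left; apply/eqP.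
by field; rewrite subr_eq0 gt_eqF.
Qed.

Lemma nadm_upper : exists C : R, 0 < C /\ forall n t, 0 <= t <= 1 ->
  1 <= beta ^+ n * t -> nadm n t <= C * (beta ^+ n * t).
Proof.
exists (beta / (beta - 1) + 1); split.
  by rewrite addr_gt0 // divr_gt0 // subr_gt0.
move=> n t t01 h; apply: le_trans (nadm_le _ t01) _.
by rewrite mulrDl mul1r lerD2l.
Qed.

Lemma expr_unbounded (x : R) : exists n, x <= beta ^+ n.
Proof.
have bern n : 1 + n%:R * (beta - 1) <= beta ^+ n.
  elim: n => [|n IH]; first by rewrite mul0r addr0.
  rewrite exprS; apply: le_trans (ler_wpM2l (ltW beta_gt0) IH).
  rewrite -natr1; have : 0 <= n%:R :> R by [].
  move: (n%:R : R) => y y0; rewrite -subr_ge0.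
  by rewrite (_ : _ - _ = y * (beta - 1) ^+ 2); [rewrite mulr_ge0 ?sqr_ge0|ring].
exists (Num.truncn (x / (beta - 1))).+1; apply: le_trans (bern _).
have : x / (beta - 1) < (Num.truncn (x / (beta - 1))).+1%:R by exact: truncnS_gt.
by rewrite ltr_pdivrMr ?subr_gt0 // => /ltW/le_trans; apply; rewrite lerDr.
Qed.

(** Going back [J] letters with [4 C <= beta^J] leaves at most half of [beta^n t] to [nadm (n - J)];
    by [nadm_add] the other half is at most [J] times [nreset n]. *)
Lemma nreset_lower : exists c b : R, 0 < c /\ forall n t, 0 <= t <= 1 ->
  b <= beta ^+ n * t -> c * (beta ^+ n * t) <= nreset n t.
Proof.
pose C := beta / (beta - 1).
have C0 : 0 < C by rewrite divr_gt0 // subr_gt0.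
have [J HJ] := expr_unbounded (4 * C).
have J0 : (0 < J.+1%:R :> R) by rewrite ltr0n.
(* [J.+1] keeps the denominator positive. The bound [4] absorbs the summand [1] of [nadm_le], and
   [beta ^+ J] forces [J <= n]. *)
exists (2 * J.+1%:R)^-1, (Num.max 4 (beta ^+ J)); split.
  by rewrite invr_gt0 mulr_gt0.
move=> n t t01; rewrite ge_max => /andP[h4 hJ].
have /andP[t0 t1] := t01.
have bn k : 0 < beta ^+ k by rewrite exprn_gt0.
have Jn : (J <= n)%N.
  rewrite -(ler_eXn2l beta_gt1); apply: le_trans hJ _.
  by rewrite ger_pMr.
have := nadm_ge n t01; have := nadm_add (n - J) J t01.
rewrite subnKC // => h1 /le_trans /(_ h1).
have := nadm_le (n - J) t01; rewrite -/C => h2 h3.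
have h5 : C * (beta ^+ (n - J) * t) <= beta ^+ n * t / 4.
  rewrite -[in leRHS](subnK Jn) exprD.
  have : beta ^+ (n - J) * t * (4 * C) <= beta ^+ (n - J) * t * beta ^+ J.
    by rewrite ler_wpM2l // mulr_ge0 // ltW.
  by lra.
have h6 : J%:R * nreset n t <= J.+1%:R * nreset n t.
  by rewrite ler_wpM2r ?nreset_ge0 // ler_nat.
rewrite mulrC ler_pdivrMr ?mulr_gt0 //; lra.
Qed.

End automaton.

(** * Bi-infinite sequences *)

Section windows.
Implicit Types (s : int -> nat) (m : int) (n : nat) (u v w : seq nat).

Definition word m n s : seq nat := mkseq (fun i => s (m + i%:Z)) n.

Definition repl m w s : int -> nat := fun k =>
  if (m <= k) && (k < m + (size w)%:Z) then nth 0%N w (absz (k - m)) else s k.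

Lemma size_word m n s : size (word m n s) = n. Proof. exact: size_mkseq. Qed.

Lemma nth_word m n s i : (i < n)%N -> nth 0%N (word m n s) i = s (m + i%:Z).
Proof. by move=> ?; rewrite nth_mkseq. Qed.

Lemma eq_word m n s s' :
  (forall i, (i < n)%N -> s (m + i%:Z) = s' (m + i%:Z)) -> word m n s = word m n s'.
Proof.
move=> h; apply: (@eq_from_nth _ 0%N); rewrite !size_word // => i ni.
by rewrite !nth_word ?h.
Qed.

Lemma word_cat m k n s : word m (k + n) s = word m k s ++ word (m + k%:Z) n s.
Proof.
apply: (@eq_from_nth _ 0%N); rewrite ?size_cat !size_word // => i ni.
rewrite nth_cat size_word; case: ltnP => ik; rewrite !nth_word //; last by lia.
by congr s; lia.
Qed.

Lemma word1 m s : word m 1 s = [:: s m].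
Proof. by rewrite /word /mkseq /= addr0. Qed.

Lemma wordS m n s : word m n.+1 s = rcons (word m n s) (s (m + n%:Z)).
Proof. by rewrite -addn1 word_cat word1 cats1. Qed.

Lemma word_repl m w s : word m (size w) (repl m w s) = w.
Proof.
apply: (@eq_from_nth _ 0%N); rewrite ?size_word // => i ni.
rewrite nth_word // /repl ifT; last by lia.
by congr nth; lia.
Qed.

Lemma repl_out m w s k : (k < m) || (m + (size w)%:Z <= k) -> repl m w s k = s k.
Proof. by move=> h; rewrite /repl ifF //; lia. Qed.

Lemma word_repl_out a n m w s :
  (a + n%:Z <= m) || (m + (size w)%:Z <= a) -> word a n (repl m w s) = word a n s.
Proof. by move=> h; apply: eq_word => i ni; rewrite repl_out //; lia. Qed.

Lemma repl_repl m u v s : size u = size v -> repl m u (repl m v s) = repl m u s.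
Proof. by move=> uv; apply/funext => k; rewrite /repl uv; case: ifP => // ->. Qed.

Lemma repl_word m n s : repl m (word m n s) s = s.
Proof.
apply/funext => k; rewrite /repl size_word; case: ifP => // h.
by rewrite nth_word; [congr s|]; lia.
Qed.

Lemma word_in m n s m' n' : (m' <= m) -> (m + n%:Z <= m' + n'%:Z) ->
  exists k, word m' n' s = word m' (absz (m - m')) s ++ word m n s ++ word (m + n%:Z) k s.
Proof.
move=> h1 h2; pose k := absz (m' + n'%:Z - (m + n%:Z))%R; exists k.
have -> : n' = ((absz (m - m')%R) + (n + k))%N by rewrite /k; lia.
by rewrite !word_cat (_ : m' + (absz (m - m')%R)%:Z = m) //; lia.
Qed.

Lemma eq_word_sub m n m' n' s s' : (m' <= m) -> (m + n%:Z <= m' + n'%:Z) ->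
  word m' n' s = word m' n' s' -> word m n s = word m n s'.
Proof.
move=> h1 h2 e; apply: eq_word => i ni.
have /(congr1 (fun w => nth 0%N w (absz (m + i%:Z - m')%R))) := e.
rewrite !nth_word; [|lia|lia].
by rewrite (_ : m' + _ = m + i%:Z) //; lia.
Qed.

End windows.

Section countable_operations.
Context d (T : measurableType d) (I : countType).

Lemma measurable_bigcup_countType (P : set I) (F : I -> set T) :
  (forall i, measurable (F i)) -> measurable (\bigcup_(i in P) F i).
Proof.
move=> mF; rewrite bigcup_mkcond; apply: countable_bigcupT_measurable => // i.
by case: ifP.
Qed.

Lemma measurable_forall (F : I -> set T) :
  (forall i, measurable (F i)) -> measurable [set x | forall i, F i x].
Proof.
move=> mF; rewrite (_ : [set _ | _] = ~` \bigcup_i ~` F i).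
  by apply/measurableC/measurable_bigcup_countType => i; exact: measurableC.
rewrite setC_bigcup; apply/seteqP; split=> x /= h i; first by move=> _; apply.
by apply: contrapT; exact: h.
Qed.

End countable_operations.

(** * The beta-shift described by states, and its Borel sets *)

Section admissible.
Variables (R : realType) (beta : R).
Hypothesis beta_gt1 : 1 < beta.

Let beta_gt0 : 0 < beta. Proof. exact: lt_trans beta_gt1. Qed.

Local Notation state := (state beta).
Local Notation step := (step beta).

(** [[0, state 1 w)] is the set of values that the iterate can take after the digits [w]: the orbit
    stays in it here, and [state_digits] shows that every value in it occurs. *)
Lemma digits_state (x : R) n : 0 <= x < 1 ->
  0 <= iter n (beta_map beta) x < state 1 (mkseq (beta_digit beta x) n).
Proof.
move=> x01; elim: n => // n /andP[h0 h1].
rewrite iterS mkseqS state_rcons; set y := iter n (beta_map beta) x in h0 h1 *.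
rewrite /beta_map subr_ge0 floor_le /=.
have by0 : 0 <= beta * y by rewrite mulr_ge0 // ltW.
have -> : (Num.floor (beta * y))%:~R = (beta_digit beta x n)%:R :> R.
  have f0 : 0 <= Num.floor (beta * y) by rewrite floor_ge0.
  by rewrite /beta_digit -/y truncEfloor; case: (Num.floor _) f0.
rewrite /step lt_max lt_min; apply/orP; right; apply/andP; split.
  by rewrite ltrBlDl natr1 truncnS_gt.
by rewrite ltrD2r ltr_pM2l.
Qed.

Lemma state_digits (w : seq nat) (y : R) : 0 <= y < state 1 w ->
  exists x : R, [/\ 0 <= x < 1, iter (size w) (beta_map beta) x = y &
    mkseq (beta_digit beta x) (size w) = w].
Proof.
elim/last_ind: w y => [|w a IH] y; first by move=> /= y01; exists y.
rewrite state_rcons /step lt_max => /andP[y0].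
rewrite ltNge y0 /= lt_min => /andP[y1 ylt].
(* The preimage of [y] under the branch of the map with digit [a]. *)
pose z := (y + a%:R) / beta.
have bz : beta * z = y + a%:R by rewrite mulrC divfK // gt_eqF.
have z0 : 0 <= z by rewrite divr_ge0 ?addr_ge0 // ltW.
have zlt : z < state 1 w by rewrite ltr_pdivrMr // mulrC -ltrBrDr.
have [|x [x01 xz xw]] := IH z; first by rewrite z0.
have dig : Num.truncn (y + a%:R) = a.
  by apply: truncn_def; rewrite lerDr y0 /= -natr1 addrC ltrD2l.
exists x; rewrite size_rcons; split=> //=.
  rewrite xz /beta_map bz (_ : Num.floor _ = a) ?addrK //.
  by apply: floor_def; rewrite rmorphD /= lerDr y0 /= addrC ltrD2l.
by rewrite mkseqS xw /beta_digit xz bz dig.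
Qed.

(** A block starting at place [k] of an expansion is an initial block of the expansion of the [k]-th
    iterate, which lies again in [[0, 1)]. *)
Lemma beta_admissibleP (s : int -> nat) m n :
  beta_admissible beta s m n <-> 0 < state 1 (word m n s).
Proof.
split=> [[x x01 [k h]]|h].
  have y01 : 0 <= iter k (beta_map beta) x < 1.
    have /andP[-> h1] := digits_state k x01; apply: lt_le_trans h1 _.
    exact: state_le1.
  have := digits_state n y01; move=> /andP[/le_lt_trans] /[apply].
  suff -> : mkseq (beta_digit beta (iter k (beta_map beta) x)) n = word m n s by [].
  apply: (@eq_from_nth _ 0%N); rewrite size_mkseq ?size_word // => i ni.
  by rewrite nth_mkseq // nth_word // h // /beta_digit addnC iterD.
have [|x [x01 _ xw]] := @state_digits (word m n s) 0; first by rewrite lexx.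
exists x => //; exists 0%N => i ni; rewrite size_word in xw.
by rewrite add0n -(nth_word m s ni) -xw nth_mkseq.
Qed.

Definition allowed (s : int -> nat) := forall m n, 0 < state 1 (word m n s).

Lemma beta_shiftP (s : int -> nat) : beta_shift beta s <-> allowed s.
Proof.
split=> [[_ h] m n|h]; first exact/beta_admissibleP.
split=> [n|m n]; last exact/beta_admissibleP.
have := h n 1%N; rewrite word1 /= step_gt0 mulr1 => /ltW.
by rewrite truncn_ge_nat // ltW.
Qed.

(** Positivity of the state passes to prefixes because [0] is absorbing, and to suffixes because
    [state] is monotone and [1] is the largest state; so windows exhausting the integers suffice. *)
Lemma allowedP (s : int -> nat) :
  (forall j : nat, exists m n, [/\ m <= - j%:Z, j%:Z <= m + n%:Z & 0 < state 1 (word m n s)]) ->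
  allowed s.
Proof.
move=> h m n; have [m' [n' [h1 h2]]] := h (absz m + absz (m + n%:Z)%R)%N.
have [||k ->] := @word_in m n s m' n'; [lia|lia|].
move/state_gt0_suffix => /(_ beta_gt1 (lexx 1)) /state_gt0_prefix; apply => //.
Qed.

Notation X := (beta_shift_borel beta).

Definition coord (x : X) : int -> nat := set_val x.

Lemma coord_allowed x : allowed (coord x).
Proof. by case: x => s sX; apply/beta_shiftP; exact: set_mem sX. Qed.

Lemma coord_inj : injective coord.
Proof. by move=> x y; exact: val_inj. Qed.

Lemma coord_surj s : allowed s -> exists x, coord x = s.
Proof.
by move=> /beta_shiftP sX; exists (exist _ s (mem_set sX)).
Qed.

Definition cset (N : nat) (P : set (seq nat)) : set X :=
  [set x | P (word (- N%:Z) (N + N) (coord x))].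

Lemma open_coord n a : open ([set x | coord x n = a] : set (beta_shift_space beta)).
Proof.
exists (proj n @^-1` [set a]) => //.
apply: open_comp; first by move=> *; exact: (@proj_continuous int (fun=> nat)).
exact: discrete_open.
Qed.

Lemma measurable_coord n a : measurable [set x | coord x n = a].
Proof. by apply: sub_sigma_algebra; exact: open_coord. Qed.

(** The centred windows of a point generate a filter that converges to it in each coordinate, hence
    in the product topology. *)
Lemma open_cset (U : set (beta_shift_space beta)) : open U ->
  U = \bigcup_N cset N [set w | cset N [set w] `<=` U].
Proof.
move=> oU; apply/seteqP; split; last first.
  by move=> x [N _ /= ] /(_ x); apply.
case: oU => V oV <- x /= Vx.
have nV : nbhs (set_val x : {ptws int -> nat}) V by exact: open_nbhs_nbhs.
pose A N := [set s : {ptws int -> nat} |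
   word (- N%:Z) (N + N) s = word (- N%:Z) (N + N) (coord x)].
pose F : set_system {ptws int -> nat} := filter_from setT A.
have FF : Filter F.
  apply: filter_from_filter; first by exists 0%N.
  move=> i j _ _; exists (maxn i j) => // s /= h.
  by split; apply: eq_word_sub h; lia.
have : F --> (set_val x : {ptws int -> nat}).
  apply/cvg_sup => k W [W' [[B] oB <-]] /= Bx BW.
  apply: (@filterS _ _ _ _ _ BW); exists (absz k).+1 => // s /= h.
  suff : s k = coord x k by rewrite /= /proj => ->.
  have : word k 1 s = word k 1 (coord x) by apply: eq_word_sub h; lia.
  by rewrite !word1 => -[].
move=> /(_ _ nV) [N _ AV]; exists N => // y /= e.
by apply: AV.
Qed.

Lemma measurable_word m n w : measurable [set x | word m n (coord x) = w].
Proof.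
have [sw|sw] := eqVneq (size w) n; last first.
  rewrite (_ : [set _ | _] = set0) //; apply/seteqP; split=> // x /= e.
  by move: sw; rewrite -e size_word eqxx.
rewrite (_ : [set _ | _] =
  \bigcap_(i in [set i | (i < n)%N]) [set x | coord x (m + i%:Z) = nth 0%N w i]).
  by apply: bigcap_measurableType => i _; exact: measurable_coord.
apply/seteqP; split=> x /=; first by move=> <- i /= ni; rewrite nth_word.
move=> h; apply: (@eq_from_nth _ 0%N); rewrite size_word // => i ni.
by rewrite nth_word // h.
Qed.

Lemma measurable_wordP m n P : measurable [set x | P (word m n (coord x))].
Proof.
rewrite (_ : [set _ | _] = \bigcup_(w in P) [set x | word m n (coord x) = w]).
  by apply: measurable_bigcup_countType => w; exact: measurable_word.
by apply/seteqP; split=> x /=; [move=> Px; eexists; first exact: Px|case=> w /= ? ->].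
Qed.

Definition csets : set (set X) := [set A | exists N P, A = cset N P].

Lemma measurable_csets : @measurable _ X = <<s csets >>.
Proof.
apply/seteqP; split.
  apply: smallest_sub; first exact: smallest_sigma_algebra.
  move=> U oU; rewrite (open_cset oU).
  apply: (@bigcup_measurable _ (g_sigma_algebraType csets)) => N _.
  by apply: sub_sigma_algebra; eexists; eexists.
apply: smallest_sub; first exact: sigma_algebra_measurable.
by move=> _ [N [P ->]]; exact: measurable_wordP.
Qed.

End admissible.

(** * Replacing a window *)

Section replacement.
Variables (R : realType) (beta : R).
Hypothesis beta_gt1 : 1 < beta.

Local Notation X := (beta_shift_borel beta).
Local Notation allowed := (allowed beta).
Implicit Types (x y : X) (A E : set X) (m : int) (u v w : seq nat).

Lemma measurable_determined m n A :
  (forall x y, word m n (coord x) = word m n (coord y) -> A x -> A y) ->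
  measurable A.
Proof.
move=> h; pose P := [set w | exists2 y, A y & word m n (coord y) = w].
rewrite (_ : A = [set x | P (word m n (coord x))]).
  exact: (@measurable_wordP _ _ _ _ P).
apply/seteqP; split=> x /=; first by exists x.
by move=> [y Ay /h]; apply.
Qed.

Definition cyl m w : set X := [set x | word m (size w) (coord x) = w].

Lemma measurable_cyl m w : measurable (cyl m w).
Proof. exact: measurable_word. Qed.

(** Off [substable m w] this is the identity, a default that keeps the map total and measurable. *)
Definition subst m w x : X :=
  if pselect (exists y : X, coord y = repl m w (coord x)) is left h
  then sval (cid h) else x.

Definition substable m w : set X := [set x | allowed (repl m w (coord x))].

Lemma coord_subst m w x : substable m w x -> coord (subst m w x) = repl m w (coord x).
Proof.
move=> sx; rewrite /subst; case: pselect => [h|]; first by case: cid.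
by case; exact: (coord_surj beta_gt1).
Qed.

Lemma subst_id m w x : ~ substable m w x -> subst m w x = x.
Proof.
rewrite /subst; case: pselect => // h []; case: h => y yE.
by rewrite /substable /= -yE; exact: coord_allowed.
Qed.

Lemma determined_repl m w (P : (int -> nat) -> Prop) m' n' :
  (forall s s', word m' n' s = word m' n' s' -> P s -> P s') ->
  measurable [set x : X | P (repl m w (coord x))].
Proof.
move=> h; apply: (@measurable_determined m' n') => x y e /=; apply: h.
apply: eq_word => i ni; rewrite /repl; case: ifP => // _.
have /(congr1 (fun w => nth 0%N w i)) := e.
by rewrite !nth_word.
Qed.

Lemma measurable_substable m w : measurable (substable m w).
Proof.
apply: (@measurable_forall _ _ _ (fun m' : int => [set x | forall n,
  0 < state beta 1 (word m' n (repl m w (coord x)))])) => m'.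
apply: (@measurable_forall _ _ _ (fun n => [set x |
  0 < state beta 1 (word m' n (repl m w (coord x)))])) => n.
by apply: (@determined_repl _ _ (fun s => 0 < state beta 1 (word m' n s)) m' n) => s s' ->.
Qed.

Lemma measurable_subst m w : measurable_fun setT (subst m w).
Proof.
apply: (@measurability _ _ X X setT _ (@csets R beta)); first exact: measurable_csets.
move=> _ [_ [N [P ->]] <-]; rewrite setTI.
rewrite (_ : _ @^-1` _ =
  (substable m w `&` [set x | P (word (- N%:Z) (N + N) (repl m w (coord x)))])
  `|` (~` substable m w `&` cset N P)).
  apply: measurableU; apply: measurableI.
  - by apply: measurable_substable.
  - apply: (@determined_repl _ _ (fun s => P (word (- N%:Z) (N + N) s)) (- N%:Z) (N + N)).
    by move=> s s' ->.
  - by apply: measurableC; apply: measurable_substable.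
  - exact: measurable_wordP.
apply/seteqP; split=> x /=.
  have [h|h] := pselect (substable m w x).
    by rewrite /cset /= coord_subst // => ?; left.
  by rewrite /cset /= subst_id // => ?; right.
by case=> -[h]; [rewrite /cset /= coord_subst|rewrite subst_id].
Qed.

Lemma subst_in m u v x : size u = size v -> cyl m u x -> substable m v x ->
  [/\ cyl m v (subst m v x), substable m u (subst m v x) &
      subst m u (subst m v x) = x].
Proof.
move=> uv cx sx; have e : repl m u (repl m v (coord x)) = coord x.
  by rewrite repl_repl // -cx repl_word.
have su : substable m u (subst m v x).
  by rewrite /substable /= coord_subst // e; exact: coord_allowed.
split => //; first by rewrite /cyl /= coord_subst // word_repl.
by apply: coord_inj; rewrite coord_subst // coord_subst.
Qed.

Lemma subst_image m u v E : size u = size v -> E `<=` cyl m u `&` substable m v ->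
  subst m v @` E = cyl m v `&` substable m u `&` subst m u @^-1` E.
Proof.
move=> uv sE; apply/seteqP; split=> [_ [x Ex <-]|y [[cy sy] /= Ey]].
  have [cx sx] := sE _ Ex; have [? ? h] := subst_in uv cx sx.
  by do ?split => //=; rewrite h.
exists (subst m u y) => //.
by have [] := subst_in (esym uv) cy sy.
Qed.

Lemma measurable_subst_image m u v E : size u = size v -> measurable E ->
  E `<=` cyl m u `&` substable m v -> measurable (subst m v @` E).
Proof.
move=> uv mE sE; rewrite (subst_image uv sE); apply: measurableI.
  exact: measurableI (measurable_cyl _ _) (measurable_substable _ _).
by rewrite -[_ @^-1` _]setTI; exact: measurable_subst.
Qed.

(** On points that carry [u] and admit [v], the replacement changes at most [size v] coordinates and
    is undone by putting [u] back, so Gibbs invariance applies to it. *)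
Lemma gibbs_subst (mu : probability X R) m u v E : gibbs_invariant mu ->
  size u = size v -> measurable E -> E `<=` cyl m u `&` substable m v ->
  mu (subst m v @` E) = mu E.
Proof.
move=> gmu uv mE sE.
apply: (gmu E (subst m v @` E) (subst m v)).
  split => //.
  - exact: measurable_subst_image uv mE sE.
  - split; first by move=> x Ex; exists x.
    + move=> x y /set_mem Ex /set_mem Ey e.
      have [cx sx] := sE _ Ex; have [cy sy] := sE _ Ey.
      have [_ _ <-] := subst_in uv cx sx; have [_ _ <-] := subst_in uv cy sy.
      by rewrite e.
    + by [].
  - exact: measurable_funTS (measurable_subst _ _).
  exists (subst m u); split.
  - exact: measurable_funTS (measurable_subst _ _).
  - move=> _ [x Ex <-]; have [cx sx] := sE _ Ex.
    by have [_ _ ->] := subst_in uv cx sx.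
  - move=> x /set_mem Ex; have [cx sx] := sE _ Ex.
    by have [_ _ ->] := subst_in uv cx sx.
  - move=> _ /set_mem [x Ex <-]; have [cx sx] := sE _ Ex.
    by have [_ _ ->] := subst_in uv cx sx.
move=> x Ex; have [_ sx] := sE _ Ex.
apply: (@sub_finite_set _ _ ((fun i : nat => m + i%:Z) @` `I_(size v))); last first.
  exact/finite_image/finite_II.
move=> k /=; rewrite -[set_val x]/(coord x) -[set_val (subst _ _ _)]/(coord _).
rewrite coord_subst //.
have [h _|h] := boolP ((m <= k) && (k < m + (size v)%:Z)).
  by exists (absz (k - m)%R); [rewrite /=|]; lia.
by rewrite repl_out //; lia.
Qed.

(** [A] looks only at coordinates left of [m], hence survives the replacement of [u] by [v], which
    maps the first set into the second. *)
Lemma gibbs_cyl_le (mu : probability X R) m u v A : gibbs_invariant mu ->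
  size u = size v -> measurable A ->
  (forall x y, (forall k, k < m -> coord x k = coord y k) -> A x -> A y) ->
  A `&` cyl m u `<=` substable m v ->
  (mu (A `&` cyl m u) <= mu (A `&` cyl m v))%E.
Proof.
move=> gmu uv mA dA sA.
have sE : A `&` cyl m u `<=` cyl m u `&` substable m v.
  by move=> x h; split; [case: h|exact: sA].
have mE : measurable (A `&` cyl m u) by apply: measurableI => //; exact: measurable_cyl.
rewrite -(gibbs_subst gmu uv mE sE); apply: le_measure.
- by rewrite inE; exact: measurable_subst_image uv mE sE.
- by rewrite inE; apply: measurableI => //; exact: measurable_cyl.
move=> _ [x Ex <-]; have [cx sx] := sE _ Ex.
have [? _ _] := subst_in uv cx sx; split => //.
case: Ex => Ax _; apply: dA Ax => k km.
by rewrite coord_subst // repl_out // km.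
Qed.

End replacement.

(** * Cylinder bounds *)

Section probability_lemmas.
Context d (T : measurableType d) (R : realType) (mu : probability T R).
Implicit Types (A B : set T).

Definition pr A : R := fine (mu A).

Lemma prE A : measurable A -> (pr A)%:E = mu A.
Proof. by move=> mA; rewrite /pr fineK // fin_num_measure. Qed.

Lemma pr_ge0 A : 0 <= pr A.
Proof. by rewrite /pr fine_ge0. Qed.

Lemma prT : pr setT = 1.
Proof. by rewrite /pr probability_setT. Qed.

Lemma pr0 : pr set0 = 0.
Proof. by rewrite /pr measure0. Qed.

Lemma prU A B : measurable A -> measurable B -> A `&` B = set0 ->
  pr (A `|` B) = pr A + pr B.
Proof.
move=> mA mB AB; apply: EFin_inj.
by rewrite EFinD !prE ?measureU //; exact: measurableU.
Qed.

Lemma pr_partition (I : choiceType) (s : seq I) (F : I -> set T) A : uniq s ->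
  measurable A -> (forall i, measurable (F i)) ->
  (forall x, A x -> exists2 i, i \in s & F i x) ->
  (forall i j x, F i x -> F j x -> i = j) ->
  pr A = \sum_(i <- s) pr (A `&` F i).
Proof.
move=> us mA mF cov dis; apply: EFin_inj; rewrite prE //.
have mAF i : measurable (A `&` F i) by exact: measurableI.
rewrite -sumEFin; under eq_bigr do rewrite prE //.
rewrite fsbig_seq // -measure_fin_bigcup //.
- congr (mu _); apply/seteqP; split=> x; last by case=> i _ [].
  by move=> Ax; have [i ? ?] := cov _ Ax; exists i.
- by move=> i j _ _ [x [[_ ?] [_ ?]]]; exact: (dis i j x).
Qed.

End probability_lemmas.

Section cylinder_bounds.
Variables (R : realType) (beta : R).
Hypothesis beta_gt1 : 1 < beta.

Let beta_gt0 : 0 < beta. Proof. exact: lt_trans beta_gt1. Qed.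

Local Notation X := (beta_shift_borel beta).
Local Notation M := (Num.truncn beta).+1.
Local Notation Ws := (words M).
Local Notation state := (state beta).
Local Notation cyl := (@cyl R beta).
Local Notation nreset := (nreset beta).
Local Notation nadm := (nadm beta).

Implicit Types (x : X) (A : set X) (m a : int) (u v w b : seq nat).

Lemma word_mem m n x : word m n (coord x) \in Ws n.
Proof.
rewrite mem_words size_word eqxx /=; apply/allP => _ /mapP[i _ ->].
have := coord_allowed beta_gt1 x (m + i%:Z) 1%N; rewrite word1 /= step_gt0 mulr1 => /ltW h.
by rewrite ltnS truncn_ge_nat // ltW.
Qed.

Lemma cyl_cat m u v : cyl m (u ++ v) = cyl m u `&` cyl (m + (size u)%:Z) v.
Proof.
apply/seteqP; split=> x; rewrite /cyl /= size_cat word_cat.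
  by move/eqP; rewrite eqseq_cat ?size_word // => /andP[/eqP ? /eqP ?].
by case=> -> ->.
Qed.

Lemma cyl_eq0 m w : ~~ (0 < state 1 w) -> cyl m w = set0.
Proof.
move=> h; apply/seteqP; split=> // x cx; apply: (negP h).
by rewrite -cx; exact: coord_allowed.
Qed.

Section fixed_probability.
Variable mu : probability X R.
Local Notation P := (pr mu).

Lemma pr_words m n A : measurable A -> P A = \sum_(w <- Ws n) P (A `&` cyl m w).
Proof.
move=> mA.
rewrite (@pr_partition _ _ _ mu _ (Ws n) (fun w => [set x | word m n (coord x) = w])).
- by rewrite big_seq [RHS]big_seq; apply: eq_bigr => w /size_words <-.
- exact: uniq_words.
- by [].
- by move=> w; exact: measurable_word.
- by move=> x _; eexists; last by []; exact: word_mem.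
- by move=> u v x /= <- <-.
Qed.

Hypothesis gmu : gibbs_invariant mu.

(* The digit [1] may follow the past of [x] before [a]; the digit [0] then resets
   the state to [1]. *)
Definition extendable a : set X :=
  [set x | forall n : nat, 1 < beta * state 1 (word (a - n%:Z) n (coord x))].

Definition left_determined a A :=
  forall x y, (forall k, k < a -> coord x k = coord y k) -> A x -> A y.

Variables (a : int) (A : set X).
Hypotheses (mA : measurable A) (dA : left_determined a A) (eA : A `<=` extendable a).

(** The old past followed by [0] has state [1], [b] leads back to [1], and from [1] the old future
    is allowed. *)
Lemma extendable_subst b x : state 1 b = 1 -> A x -> substable a (0%N :: b) x.
Proof.
move=> b1 Ax; apply: (allowedP beta_gt1) => j.
(* With this margin on both sides of the replaced word the window contains [[-j, j)]. *)
pose k := (absz a + j)%N; have kE : k = (absz a + j)%N by [].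
exists (a - k%:Z), (k + (size (0%N :: b) + k))%N.
split; [lia|lia|clearbody k].
rewrite (word_cat _ k) (word_cat _ (size _)) subrK.
rewrite word_repl !word_repl_out; [|lia|lia].
rewrite !state_cat /= (_ : step _ _ 0 = 1); first by rewrite b1; exact: coord_allowed.
by apply/eqP; rewrite step_eq1 add0r; apply/ltW/(eA Ax).
Qed.

Lemma pr_extendable_le u b : size u = (size b).+1 -> state 1 b = 1 ->
  P (A `&` cyl a u) <= P (A `&` cyl a (0%N :: b)).
Proof.
move=> ub b1; rewrite -lee_fin !prE; last 2 first.
- by apply: measurableI => //; exact: measurable_cyl.
- by apply: measurableI => //; exact: measurable_cyl.
by apply: gibbs_cyl_le => // x [Ax _]; exact: extendable_subst.
Qed.

(** Split [A] along the window at [a]: none of the [nadm (size b).+1 1] admissible words has more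
    mass in [A] than [0 :: b]. *)
Lemma pr_le_nadm b : state 1 b = 1 ->
  P A <= nadm (size b).+1 1 * P (A `&` cyl a (0%N :: b)).
Proof.
move=> b1; rewrite (pr_words a (size b).+1 mA) mulr_suml.
rewrite big_seq [leRHS]big_seq; apply: ler_sum => w /size_words sw.
have [h|h] := boolP (0 < state 1 w); first by rewrite mul1r pr_extendable_le.
by rewrite mul0r cyl_eq0 // setI0 pr0.
Qed.

(** Conversely, the [nreset n 1] words [0 :: b] with [state 1 b = 1] have disjoint cylinders, each
    with at least the mass of [u] in [A]. *)
Lemma nreset_pr_le n u : size u = n.+1 -> nreset n 1 * P (A `&` cyl a u) <= P A.
Proof.
move=> su; rewrite [leRHS](pr_words a n.+1 mA) sum_words_cons big_ord_recl /=.
rewrite -[leLHS]addr0 lerD ?sumr_ge0 //; last first.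
  by move=> i _; apply: sumr_ge0 => w _; exact: pr_ge0.
rewrite mulr_suml big_seq [leRHS]big_seq; apply: ler_sum => w /size_words sw.
have [h|h] := eqVneq (state 1 w) 1; last by rewrite mul0r pr_ge0.
by rewrite mul1r pr_extendable_le // su sw.
Qed.

Lemma pr_cyl_split n n' m w : a + n%:Z = m ->
  P (A `&` cyl m w) =
  \sum_(u <- Ws n) \sum_(v <- Ws n') P (A `&` cyl a (u ++ w ++ v)).
Proof.
move=> am; have mAw : measurable (A `&` cyl m w).
  by apply: measurableI => //; exact: measurable_cyl.
rewrite (pr_words a n mAw) big_seq [RHS]big_seq; apply: eq_bigr => u /size_words su.
rewrite (pr_words (m + (size w)%:Z) n'); last first.
  by apply: measurableI => //; exact: measurable_cyl.
apply: eq_bigr => v _; congr pr.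
by rewrite !cyl_cat su am -!setIA [cyl a u `&` (cyl m w `&` _)]setICA.
Qed.

(** Among the paddings of [w], keep those of the form [0 :: u ++ w ++ v] where [u] ends in state [1]
    and [v] leads from [state 1 w] to [1]; [pr_le_nadm] bounds each of them from below. *)
Lemma pr_cyl_lower n n' m w : a + n.+1%:Z = m ->
  nreset n 1 * nreset n' (state 1 w) * P A <=
  nadm (n + (size w + n')).+1 1 * P (A `&` cyl m w).
Proof.
move=> am; rewrite (pr_cyl_split n' w am) sum_words_cons big_ord_recl mulrDr /=.
rewrite -[leLHS]addr0 lerD //; last first.
  by rewrite mulr_ge0 ?nadm_ge0 // sumr_ge0 // => i _; do 2 apply: sumr_ge0 => ? _; exact: pr_ge0.
rewrite -mulrA mulr_suml mulr_sumr big_seq [leRHS]big_seq.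
apply: ler_sum => u /size_words su.
have [u1|u1] := eqVneq (state 1 u) 1; last first.
  by rewrite mul0r mulr_ge0 ?nadm_ge0 // sumr_ge0 // => ? _; exact: pr_ge0.
rewrite mul1r mulr_suml mulr_sumr big_seq [leRHS]big_seq.
apply: ler_sum => v /size_words sv.
have [v1|v1] := eqVneq (state (state 1 w) v) 1; last first.
  by rewrite mul0r mulr_ge0 ?nadm_ge0 ?pr_ge0.
rewrite mul1r; have := @pr_le_nadm (u ++ w ++ v).
by rewrite !state_cat u1 v1 !size_cat su sv => /(_ erefl).
Qed.

(** An admissible padding [u ++ w ++ v] has [u] admissible and [v] live from [state 1 w]; this
    bounds their number, and [nreset_pr_le] bounds the mass of each. *)
Lemma pr_cyl_upper n n' m w : a + n.+1%:Z = m ->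
  nreset (n + (size w + n')) 1 * P (A `&` cyl m w) <=
  nadm n.+1 1 * nadm n' (state 1 w) * P A.
Proof.
move=> am; rewrite (pr_cyl_split n' w am) -mulrA mulr_sumr [leRHS]mulr_suml.
rewrite big_seq [leRHS]big_seq; apply: ler_sum => u /size_words su.
rewrite !(mulr_sumr, mulr_suml) big_seq [leRHS]big_seq; apply: ler_sum => v /size_words sv.
have [h|h] := boolP (0 < state 1 (u ++ w ++ v)); last first.
  by rewrite cyl_eq0 // setI0 pr0 mulr0 !mulr_ge0 ?pr_ge0.
have -> : 0 < state 1 u by exact: state_gt0_prefix h.
have -> : 0 < state (state 1 w) v.
  by have := state_gt0_suffix beta_gt1 (lexx 1) h; rewrite state_cat.
by rewrite !mul1r nreset_pr_le // !size_cat su sv.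
Qed.

End fixed_probability.

Lemma cylinder_bounds : exists c1 c2 : R, [/\ 0 < c1, 0 < c2 &
  forall m w, 0 < state 1 w -> exists n0, forall n, (n0 <= n)%N ->
    forall (mu : probability X R) A, gibbs_invariant mu -> measurable A ->
      left_determined (m - n.+1%:Z) A -> A `<=` extendable (m - n.+1%:Z) ->
      c1 * (state 1 w / beta ^+ size w) * pr mu A <= pr mu (A `&` cyl m w) <=
      c2 * (state 1 w / beta ^+ size w) * pr mu A].
Proof.
have [C [C0 hC]] := nadm_upper beta_gt1.
have [c [b [c0 hc]]] := nreset_lower beta_gt1.
exists (c * c / (C * beta)), (C * C * beta / c); split.
- by rewrite divr_gt0 ?mulr_gt0.
- by rewrite divr_gt0 ?mulr_gt0.
move=> m w t0; set t := state 1 w in t0 *.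
have t1 : t <= 1 by exact: state_le1.
(* [n'] depends on [w] alone and makes both counting bounds available from the state [t]. In the
   quotients all powers of [beta] cancel except [beta^-|w|] and one factor [beta], which goes into
   the constants. *)
have [n' hn'] := expr_unbounded beta_gt1 (Num.max b 1 / t).
have [n0 hn0] := expr_unbounded beta_gt1 b.
exists n0 => n n0n mu A gmu mA dA eA.
have bn k : 0 < beta ^+ k by rewrite exprn_gt0.
have bn1 k : 1 <= beta ^+ k by rewrite exprn_ege1 // ltW.
have mono k : (n0 <= k)%N -> b <= beta ^+ k * 1.
  by move=> h; rewrite mulr1; apply: le_trans hn0 _; rewrite ler_eXn2l.
have t01 : 0 <= t <= 1 by rewrite t1 ltW.
have i01 : (0 : R) <= 1 <= (1 : R) by rewrite lexx ler01.
have : Num.max b 1 <= beta ^+ n' * t by rewrite -ler_pdivrMr.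
rewrite ge_max => /andP[hb h1].
have am : m - n.+1%:Z + n.+1%:Z = m by rewrite subrK.
have := pr_cyl_lower gmu mA dA eA n' w am.
have := pr_cyl_upper gmu mA dA eA n' w am.
rewrite -/t; set p := pr mu A; set q := pr mu _; set N := (n + _)%N.
have p0 : 0 <= p by exact: pr_ge0. have q0 : 0 <= q by exact: pr_ge0.
have l1 := hc n' t t01 hb; have u1 := hC n' t t01 h1.
have l2 := hc n 1 i01 (mono _ n0n).
have l3 := hc N 1 i01 (mono _ (leq_trans n0n (leq_addr _ _))).
have u2 := hC n.+1 1 i01; rewrite mulr1 in u2; have {}u2 := u2 (bn1 _).
have u3 := hC N.+1 1 i01; rewrite mulr1 in u3; have {}u3 := u3 (bn1 _).
rewrite mulr1 in l2; rewrite mulr1 in l3.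
move=> hu hl.
have eN : beta ^+ N = beta ^+ n * (beta ^+ size w * beta ^+ n') by rewrite !exprD.
apply/andP; split.
  have : (c * beta ^+ n) * (c * (beta ^+ n' * t)) * p <= C * beta ^+ N.+1 * q.
    apply: le_trans (le_trans hl (ler_wpM2r q0 u3)).
    by rewrite ler_wpM2r // ler_pM // ?mulr_ge0 // ltW.
  rewrite exprS eN => h.
  rewrite -(@ler_pM2l _ (C * beta ^+ n * (beta * (beta ^+ size w * beta ^+ n')))) ?mulr_gt0 //.
  apply: le_trans (le_trans _ h) _; rewrite le_eqVlt; apply/orP; left; apply/eqP.
    by field; rewrite !gt_eqF.
  by ring.
have : c * beta ^+ N * q <= C * beta ^+ n.+1 * (C * (beta ^+ n' * t)) * p.
  apply: le_trans (le_trans (ler_wpM2r q0 l3) hu) _.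
  by rewrite ler_wpM2r // ler_pM // nadm_ge0.
rewrite exprS eN => h.
rewrite -(@ler_pM2l _ (c * (beta ^+ n * (beta ^+ size w * beta ^+ n')))) ?mulr_gt0 //.
apply: le_trans h _; rewrite le_eqVlt; apply/orP; left; apply/eqP.
by field; rewrite !gt_eqF.
Qed.

End cylinder_bounds.

(** * Uniqueness *)

Section probability_limits.
Context d (T : measurableType d) (R : realType) (mu : probability T R).

Lemma prD (A B : set T) : measurable A -> measurable B -> B `<=` A ->
  pr mu (A `\` B) = pr mu A - pr mu B.
Proof.
move=> mA mB BA; rewrite -[in RHS](setDUK BA) prU //.
- by rewrite addrAC subrr add0r.
- exact: measurableD.
- by apply/seteqP; split=> // x [? []].
Qed.

Lemma pr_nondecreasing_cvg (F : nat -> set T) :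
  (forall n, measurable (F n)) -> (forall n m, (n <= m)%N -> F n `<=` F m) ->
  pr mu (F n) @[n --> \oo] --> pr mu (\bigcup_n F n).
Proof.
move=> mF ndF; apply: (@fine_cvg _ _ _ _ (mu \o F)).
rewrite prE; last exact: bigcupT_measurable.
apply: nondecreasing_cvg_mu => //; first exact: bigcupT_measurable.
by move=> n m nm; apply/subsetPset; exact: ndF.
Qed.

Lemma pr_nonincreasing_cvg (F : nat -> set T) :
  (forall n, measurable (F n)) -> (forall n m, (n <= m)%N -> F m `<=` F n) ->
  pr mu (F n) @[n --> \oo] --> pr mu (\bigcap_n F n).
Proof.
move=> mF ndF; apply: (@fine_cvg _ _ _ _ (mu \o F)).
rewrite prE; last exact: bigcapT_measurable.
apply: nonincreasing_cvg_mu => //.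
- by rewrite (le_lt_trans (probability_le1 _ _)) ?ltry.
- exact: bigcapT_measurable.
by move=> n m nm; apply/subsetPset; exact: ndF.
Qed.

Lemma pr_sigma_additive (F : nat -> set T) :
  (forall n, measurable (F n)) -> trivIset setT F ->
  \sum_(0 <= i < n) pr mu (F i) @[n --> \oo] --> pr mu (\bigcup_n F n).
Proof.
move=> mF tF; have mU := bigcupT_measurable F mF.
have : (\sum_(0 <= i < n) mu (F i))%E @[n --> \oo] --> (pr mu (\bigcup_n F n))%:E.
  by rewrite prE //; exact: measure_semi_sigma_additive.
move/fine_cvg; apply: cvg_trans; apply: near_eq_cvg; apply: nearW => n /=.
by rewrite sum_fine // => i _; rewrite fin_num_measure.
Qed.

End probability_limits.

(** * The probability on the line from [mu] through [nu], beyond [nu] *)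

Section extrapolation.
Context d (T : measurableType d) (R : realType) (mu nu : probability T R) (K : R).
Hypothesis K1 : 1 < K.
Hypothesis le_munu : forall A, measurable A -> pr mu A <= K * pr nu A.

(* A measure of the library is nonnegative on every set, hence the default value
   off the sigma-algebra. *)
Definition extrapolated (A : set T) : \bar R :=
  if pselect (measurable A) then ((K * pr nu A - pr mu A) / (K - 1))%:E else 0%E.

Local Notation lam := extrapolated.

Let lamE A : measurable A -> lam A = ((K * pr nu A - pr mu A) / (K - 1))%:E.
Proof. by move=> mA; rewrite /extrapolated; case: pselect. Qed.

Let lam0 : lam set0 = 0%E.
Proof. by rewrite lamE // !pr0 mulr0 subrr mul0r. Qed.

Let lam_ge0 A : (0 <= lam A)%E.
Proof.
rewrite /extrapolated; case: pselect => //= mA.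
by rewrite lee_fin divr_ge0 ?subr_ge0 ?le_munu // ltW.
Qed.

Let lam_sigma_additive : semi_sigma_additive lam.
Proof.
move=> F mF tF mUF; rewrite lamE //.
have -> : (fun n => \sum_(0 <= i < n) lam (F i))%E = (fun n =>
   ((K * (\sum_(0 <= i < n) pr nu (F i)) - \sum_(0 <= i < n) pr mu (F i)) / (K - 1))%:E).
  apply/funext => n; rewrite mulr_sumr -sumrB mulr_suml -sumEFin.
  by apply: eq_bigr => i _; rewrite lamE.
apply: cvg_EFin; first exact: nearW.
apply: cvgMl; apply: cvgB; last exact: pr_sigma_additive.
by apply: cvgMr; exact: pr_sigma_additive.
Qed.

HB.instance Definition _ := isMeasure.Build _ _ _ lam lam0 lam_ge0 lam_sigma_additive.

Let lamT : lam setT = 1%E.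
Proof. by rewrite lamE // !prT mulr1 divff // subr_eq0 gt_eqF. Qed.

HB.instance Definition _ := Measure_isProbability.Build _ _ _ lam lamT.

Lemma extrapolation : exists la : probability T R, forall A, measurable A ->
  pr la A = (K * pr nu A - pr mu A) / (K - 1).
Proof. by exists lam => A mA; exact: (congr1 fine (lamE mA)). Qed.

End extrapolation.

(** * Comparison of Gibbs invariant probabilities *)

Section uniqueness.
Variables (R : realType) (beta : R).
Hypothesis beta_gt1 : 1 < beta.

Let beta_gt0 : 0 < beta. Proof. exact: lt_trans beta_gt1. Qed.

Local Notation X := (beta_shift_borel beta).
Local Notation M := (Num.truncn beta).+1.
Local Notation Ws := (words M).
Local Notation state := (state beta).
Local Notation cyl := (@cyl R beta).
Local Notation extendable := (@extendable R beta).
Implicit Types (x : X) (A B : set X) (m a : int) (u v w b : seq nat).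

Definition determined (N : nat) A := forall x y,
  word (- N%:Z) (N + N) (coord x) = word (- N%:Z) (N + N) (coord y) -> A x -> A y.

Lemma determined_cset N P : determined N (cset N P).
Proof. by move=> x y; rewrite /cset /= => ->. Qed.

Lemma csets_determined N A : determined N A -> csets A.
Proof.
move=> dA; exists N, [set w | exists2 y, A y & word (- N%:Z) (N + N) (coord y) = w].
apply/seteqP; split=> x /=; first by exists x.
by move=> [y Ay /dA]; apply.
Qed.

Lemma determined_widen N N' A : (N <= N')%N -> determined N A -> determined N' A.
Proof. by move=> NN' dA x y e; apply: dA; apply: eq_word_sub e; lia. Qed.

Lemma csetsP A : csets A <-> exists N, determined N A.
Proof.
split=> [[N [P ->]]|[N /csets_determined //]].
by exists N; exact: determined_cset.
Qed.

Lemma csetsD A B : csets A -> csets B -> csets (A `\` B).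
Proof.
move=> /csetsP[N dA] /csetsP[N' dB]; apply/csetsP; exists (maxn N N').
have {}dA := determined_widen (leq_maxl N N') dA.
have {}dB := determined_widen (leq_maxr N N') dB.
by move=> x y e [Ax nBx]; split; [exact: dA Ax|move=> By; apply: nBx; exact: dB By].
Qed.

Lemma csetsT : csets (setT : set X).
Proof. by apply/csetsP; exists 0%N. Qed.

Lemma csetsI : setI_closed (@csets R beta).
Proof.
move=> A B cA cB; rewrite -(setCK B) -setDE -setTD.
by do 2!apply: csetsD => //; exact: csetsT.
Qed.

Lemma measurable_cset A : csets A -> measurable A.
Proof. by case=> N [P ->]; exact: measurable_wordP. Qed.

Section comparison.
Variables mu nu : probability X R.

(** The sets that window sets approximate in both measures at once form a lambda-system, and the
    window sets are closed under intersection and generate the Borel sets. *)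
Lemma csets_approx A : measurable A -> forall e, 0 < e -> exists2 C, csets C &
  pr mu (A `\` C `|` C `\` A) + pr nu (A `\` C `|` C `\` A) < e.
Proof.
pose Y A C : set X := A `\` C `|` C `\` A.
pose f A := pr mu A + pr nu A.
have f_sub A1 A2 A3 : measurable A1 -> measurable A2 -> measurable A3 ->
    A1 `<=` A2 `|` A3 -> f A1 <= f A2 + f A3.
  move=> m1 m2 m3 s; rewrite /f addrACA; apply: lerD.
    rewrite -lee_fin EFinD !prE //; apply: le_trans (measureU2 _ _ _) => //.
    by rewrite le_measure ?inE //; exact: measurableU.
  rewrite -lee_fin EFinD !prE //; apply: le_trans (measureU2 _ _ _) => //.
  by rewrite le_measure ?inE //; exact: measurableU.
have mY A1 A2 : measurable A1 -> measurable A2 -> measurable (Y A1 A2).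
  by move=> m1 m2; apply: measurableU; exact: measurableD.
have fc C : f (Y C C) = 0 by rewrite /f /Y setDv setUid !pr0 addr0.
suff h : (@measurable _ X) `<=`
    [set A | measurable A /\ forall e, 0 < e -> exists2 C, csets C & f (Y A C) < e].
  by move=> /h [_].
rewrite [X in X `<=` _]measurable_csets //; apply: lambda_system_subset => //.
- exact: csetsI.
- split => //.
  + by split => // e e0; exists setT; rewrite ?fc //; exact: csetsT.
  + move=> A1 A2 A21 [m1 h1] [m2 h2]; split; first exact: measurableD.
    move=> e e0; have e2 : 0 < e / 2 by rewrite divr_gt0.
    have [C1 c1 f1] := h1 _ e2; have [C2 c2 f2] := h2 _ e2.
    have mc1 := measurable_cset c1; have mc2 := measurable_cset c2.
    exists (C1 `\` C2); first exact: csetsD.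
    apply: le_lt_trans (f_sub _ (Y A1 C1) (Y A2 C2) _ _ _ _) _.
    * by apply: mY; exact: measurableD.
    * exact: mY.
    * exact: mY.
    * move=> x [[[a1 a2] h]|[[a1 a2] h]].
        have [C1x|C1x] := pselect (C1 x); last by left; left.
        by right; right; split=> //; apply: contrapT => C2x; exact: h.
      have [A1x|A1x] := pselect (A1 x); last by left; right.
      by right; left; split=> //; apply: contrapT => A2x; exact: h.
    by rewrite [e]splitr ltrD.
  + move=> F ndF hF; have mF n : measurable (F n) by have [] := hF n.
    have mUF : measurable (\bigcup_n F n) by exact: bigcupT_measurable.
    split=> // e e0; have e2 : 0 < e / 2 by rewrite divr_gt0.
    have ndF' n k : (n <= k)%N -> F n `<=` F k by move/ndF/subsetPset.
    have : f (F n) @[n --> \oo] --> f (\bigcup_n F n).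
      by apply: cvgD; exact: pr_nondecreasing_cvg.
    move=> /cvgrPdist_lt /(_ _ e2) [n _ /(_ n (leqnn n))] /= fn.
    have {}fn : f (\bigcup_n F n `\` F n) < e / 2.
      have FU : F n `<=` \bigcup_n F n by move=> x ?; exists n.
      rewrite /f !prD //; apply: le_lt_trans fn.
      by apply: le_trans (ler_norm _); rewrite /f; lra.
    have [C c fC] := (hF n).2 _ e2; exists C => //.
    have mc := measurable_cset c.
    apply: le_lt_trans (f_sub _ (\bigcup_n F n `\` F n) (Y (F n) C) _ _ _ _) _.
    * exact: mY.
    * exact: measurableD.
    * exact: mY.
    * move=> x [[Ux nC]|[Cx nU]].
        have [Fx|Fx] := pselect (F n x); last by left.
        by right; left.
      by right; right; split => // Fx; apply: nU; exists n.
    by rewrite [e]splitr ltrD.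
- move=> B cB; split; first exact: measurable_cset.
  by move=> e e0; exists B; rewrite ?fc.
Qed.

(** A window set is a finite disjoint union of cylinders, and every measurable set is close to one
    window set in [mu] and [nu] simultaneously. *)
Lemma le_pr_measurable (K : R) : 0 <= K ->
  (forall m w, pr mu (cyl m w) <= K * pr nu (cyl m w)) ->
  forall A, measurable A -> pr mu A <= K * pr nu A.
Proof.
move=> K0 hK A mA.
have hC C : csets C -> pr mu C <= K * pr nu C.
  move=> cC; have mC := measurable_cset cC; case/csetsP: cC => N dC.
  rewrite (pr_words beta_gt1 mu (- N%:Z) (N + N) mC).
  rewrite (pr_words beta_gt1 nu (- N%:Z) (N + N) mC) mulr_sumr.
  rewrite big_seq [leRHS]big_seq; apply: ler_sum => w /size_words sw.
  have [[x [Cx cx]]|h] := pselect (exists x, C x /\ cyl (- N%:Z) w x).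
    rewrite (_ : C `&` cyl (- N%:Z) w = cyl (- N%:Z) w) //.
    apply/seteqP; split=> [y []//|y cy]; split=> //.
    by apply: dC Cx; rewrite -sw cx cy.
  rewrite (_ : C `&` cyl (- N%:Z) w = set0) ?pr0 ?mulr0 //.
  by apply/seteqP; split=> // x [Cx cx]; apply: h; exists x.
apply/ler_addgt0Pr => e e0.
have K1 : 0 < K + 1 by rewrite ltr_wpDl.
(* The error enters once through [mu] and [K] times through [nu]. *)
have [|C cC] := csets_approx mA (e := e / (K + 1)); first exact: divr_gt0.
have mC := measurable_cset cC; set Y := (A `\` C `|` C `\` A).
have mY : measurable Y by apply: measurableU; exact: measurableD.
rewrite ltr_pdivlMr // => h.
have sub (rho : probability X R) B1 B2 : measurable B1 -> measurable B2 ->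
    B1 `<=` B2 `|` Y -> pr rho B1 <= pr rho B2 + pr rho Y.
  move=> m1 m2 s; rewrite -lee_fin EFinD !prE //; apply: le_trans (measureU2 _ _ _) => //.
  by rewrite le_measure ?inE //; exact: measurableU.
have s1 : A `<=` C `|` Y.
  by move=> x Ax; have [?|?] := pselect (C x); [left|right; left].
have s2 : C `<=` A `|` Y.
  by move=> x Cx; have [?|?] := pselect (A x); [left|right; right].
have := sub mu _ _ mA mC s1; have := sub nu _ _ mC mA s2; have := hC C cC.
have := pr_ge0 mu Y; have := pr_ge0 nu Y.
move: h; move: (pr mu A) (pr nu A) (pr mu C) (pr nu C) (pr mu Y) (pr nu Y).
move=> a1 a2 d1 d2 y1 y2 h y20 y10 h1 h2 h3.
have h4 : K * d2 <= K * (a2 + y2) by exact: ler_wpM2l.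
have : 0 <= K * y1 by exact: mulr_ge0.
by rewrite !mulrDr in h4 *; nra.
Qed.

End comparison.

Lemma extendable_left_determined a : left_determined a (extendable a).
Proof.
move=> x y h ex n; rewrite (_ : word _ _ _ = word (a - n%:Z) n (coord x)); first exact: ex.
by apply: eq_word => i ni; rewrite h //; lia.
Qed.

Lemma measurable_extendable a : measurable (extendable a).
Proof.
apply: (@measurable_forall _ _ _ (fun n => [set x : X |
  1 < beta * state 1 (word (a - n%:Z) n (coord x))])) => n.
exact: (@measurable_wordP _ _ _ _ (fun w => 1 < beta * state 1 w)).
Qed.

Lemma extendable_digit a x : coord x a != 0%N -> extendable a x.
Proof.
move=> xa n; have := coord_allowed beta_gt1 x (a - n%:Z) n.+1.
rewrite wordS state_rcons step_gt0 subrK => h; apply: le_lt_trans h.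
by rewrite ler1n lt0n.
Qed.

Lemma state_zeros n : state 1 (nseq n 0%N) = 1.
Proof.
elim: n => //= n IH; rewrite (_ : step _ _ _ = 1) //.
by apply/eqP; rewrite step_eq1 add0r mulr1 ltW.
Qed.

(** If all positions far to the left failed, their digits would be [0] by [extendable_digit]; but
    after zeros alone the state is [1], and the position is extendable. *)
Lemma extendable_infinitely_often x m n0 : exists2 n, (n0 <= n)%N & extendable (m - n.+1%:Z) x.
Proof.
apply: contrapT => h.
have z n : (n0 <= n)%N -> coord x (m - n.+1%:Z) = 0%N.
  move=> n0n; apply/eqP; apply/negP => /negP /extendable_digit ?.
  by apply: h; exists n.
apply: h; exists n0 => // n; rewrite (_ : word _ _ _ = nseq n 0%N).
  by rewrite state_zeros mulr1.
apply: (@eq_from_nth _ 0%N); rewrite ?size_word ?size_nseq // => i ni.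
rewrite nth_word // nth_nseq ni (_ : _ + _ = m - (n0 + (n - i))%N.+1%:Z); last by lia.
by rewrite z // leq_addr.
Qed.

(** [cylinder_bounds] applies to left-determined sets inside a single [extendable] set. Splitting by
    the leftmost extendable position of a finite range pieces the bounds together; the ranges then
    grow to the left until they catch every point. *)
Lemma gibbs_cylinder_bounds : exists c1 c2 : R, [/\ 0 < c1, 0 < c2 &
  forall (mu : probability X R) m w, gibbs_invariant mu ->
    c1 * (state 1 w / beta ^+ size w) <= pr mu (cyl m w) <=
    c2 * (state 1 w / beta ^+ size w)].
Proof.
have [c1 [c2 [c10 c20 hc]]] := cylinder_bounds beta_gt1.
exists c1, c2; split=> // mu m w gmu.
have [w0|w0] := boolP (0 < state 1 w); last first.
  rewrite cyl_eq0 // pr0 (_ : state 1 w = 0) ?mul0r ?mulr0 ?lexx //.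
  by apply: le_anti; rewrite leNgt w0 state_ge0.
have [n0 hn] := hc m w w0.
set g := state 1 w / beta ^+ size w.
pose S i j := [set x : X | exists n, [/\ (i <= n)%N, (n < j)%N & extendable (m - n.+1%:Z) x]].
have mS i j : measurable (S i j).
  rewrite (_ : S i j = \bigcup_(n in [set n | (i <= n < j)%N]) extendable (m - n.+1%:Z)).
    by apply: bigcup_measurable => n _; exact: measurable_extendable.
  by apply/seteqP; split=> x [n]; [case=> ? ? ?|case/andP => ? ? ?]; exists n => //=; apply/andP.
have dS i j : left_determined (m - i.+1%:Z) (S i j).
  move=> x y h [n [n1 n2 en]]; exists n; split => //.
  apply: extendable_left_determined en => k kn; apply: h; lia.
have mC := measurable_cyl m w : measurable (cyl m w : set X).
have bS d : forall i j, (n0 <= i)%N -> (j - i = d)%N ->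
  c1 * g * pr mu (S i j) <= pr mu (S i j `&` cyl m w) <= c2 * g * pr mu (S i j).
  elim: d => [|d IH] i j n0i ji.
    rewrite (_ : S i j = set0) ?set0I ?pr0 ?mulr0 ?lexx //.
    by apply/seteqP; split=> // x [n [? ? _]]; lia.
  have /andP[l1 u1] := IH i.+1 j (leqW n0i) ltac:(lia).
  (* The points whose leftmost extendable position in the range is [m - i.+1]. What is removed is
     decided further left, so [A] stays left-determined. *)
  pose A : set X := extendable (m - i.+1%:Z) `\` S i.+1 j.
  have mA : measurable A by apply: measurableD => //; exact: measurable_extendable.
  have dA : left_determined (m - i.+1%:Z) A.
    move=> x y h [ex nS]; split; first exact: extendable_left_determined ex.
    move=> Sy; apply: nS; apply: dS Sy => k ki; rewrite h //; lia.
  have /andP[l2 u2] := hn i n0i mu A gmu mA dA (@subDsetl _ _ _).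
  have -> : S i j = S i.+1 j `|` A.
    apply/seteqP; split=> x.
      move=> [n [n1 n2 en]]; have [h|h] := pselect (S i.+1 j x); first by left.
      right; split => //; move: n1; rewrite leq_eqVlt => /orP[/eqP -> //|n1].
      by case: h; exists n.
    case=> [[n [n1 n2 en]]|[ex _]]; first by exists n; split => //; exact: ltnW.
    by exists i; split => //; lia.
  have dis : S i.+1 j `&` A = set0.
    by apply/seteqP; split=> // x [? []].
  rewrite setIUl !prU //.
  - by rewrite !mulrDr !lerD.
  - exact: measurableI.
  - exact: measurableI.
  - by rewrite setIACA dis set0I.
have cS : \bigcup_j S n0 j = setT.
  rewrite -subTset => x _; have [n n0n en] := extendable_infinitely_often x m n0.
  by exists n.+1 => //; exists n.
have ndS j k : (j <= k)%N -> S n0 j `<=` S n0 k.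
  by move=> jk x [n [? ? ?]]; exists n; split => //; exact: leq_trans jk.
have lim1 : pr mu (S n0 j) @[j --> \oo] --> (1 : R^o).
  by rewrite -(prT mu) -cS; exact: pr_nondecreasing_cvg.
have lim2 : pr mu (S n0 j `&` cyl m w) @[j --> \oo] --> pr mu (cyl m w).
  rewrite -[in X in _ --> X](setTI (cyl m w)) -cS setI_bigcupl.
  apply: pr_nondecreasing_cvg => [j|j k jk]; first exact: measurableI.
  by apply: setSI; exact: ndS.
have bounds j : c1 * g * pr mu (S n0 j) <= pr mu (S n0 j `&` cyl m w) <= c2 * g * pr mu (S n0 j).
  exact: (bS (j - n0)%N).
apply/andP; split.
- have h : c1 * g * pr mu (S n0 j) @[j --> \oo] --> c1 * g * 1 by exact: cvgMr.
  rewrite -[c1 * g]mulr1; apply: (ler_cvg_to h lim2).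
  by apply: nearW => j; have /andP[] := bounds j.
- have h : c2 * g * pr mu (S n0 j) @[j --> \oo] --> c2 * g * 1 by exact: cvgMr.
  rewrite -[c2 * g]mulr1; apply: (ler_cvg_to lim2 h).
  by apply: nearW => j; have /andP[] := bounds j.
Qed.

Definition dominates (K : R) := forall mu nu : probability X R,
  gibbs_invariant mu -> gibbs_invariant nu ->
  forall A, measurable A -> pr mu A <= K * pr nu A.

Lemma dominates_exists : exists2 K, 1 < K & dominates K.
Proof.
have [c1 [c2 [c10 c20 hc]]] := gibbs_cylinder_bounds.
exists (1 + c2 / c1); first by rewrite ltrDl divr_gt0.
move=> mu nu gmu gnu; have K0 : 0 <= 1 + c2 / c1 by rewrite addr_ge0 // divr_ge0 ?ltW.
apply: le_pr_measurable => // m w.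
have /andP[_ h1] := hc mu m w gmu; have /andP[h2 _] := hc nu m w gnu.
apply: le_trans h1 _; rewrite mulrDl mul1r -[leLHS]add0r lerD ?pr_ge0 //.
set g := state 1 w / _ in h2 *.
rewrite (_ : c2 * g = c2 / c1 * (c1 * g)); last by field; rewrite gt_eqF.
by rewrite ler_wpM2l // divr_ge0 // ltW.
Qed.

(** With [la = ((1 + e) nu - mu) / e], the bound [mu <= (1 + e) la] reads
    [(1 + 2 e) mu <= (1 + e)^2 nu], and [(1 + e)^2 <= (1 + e / 2) (1 + 2 e)]. *)
Lemma dominates_improve e : 0 < e -> dominates (1 + e) -> dominates (1 + e / 2).
Proof.
move=> e0 dom mu nu gmu gnu A mA.
have K1 : 1 < 1 + e by rewrite ltrDl.
have [la hla] := extrapolation K1 (dom mu nu gmu gnu).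
have gla : gibbs_invariant la.
  move=> B C g iso gg; have [mB mC bij _ _] := iso.
  have gB : g @` B = C by exact: surj_image_eq (set_bij_sub bij) (set_bij_surj bij).
  rewrite -!prE // ?gB // !hla //.
  have := gmu _ _ _ iso gg; have := gnu _ _ _ iso gg; rewrite gB.
  by rewrite -!prE // => -[->] [->].
have := dom mu la gmu gla A mA; rewrite hla //.
rewrite (addrC 1 e) addrK mulrA ler_pdivlMr //.
have := pr_ge0 nu A; have := pr_ge0 mu A.
move: (pr mu A) (pr nu A) => p q p0 q0 h.
have h1 : p * (1 + 2 * e) <= (1 + e) ^+ 2 * q by lra.
have h2 : (1 + e) ^+ 2 * q <= (1 + e / 2) * q * (1 + 2 * e).
  have -> : (1 + e / 2) * q * (1 + 2 * e) = (1 + e) ^+ 2 * q + (e / 2) * q by field.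
  by rewrite lerDl mulr_ge0 // divr_ge0 // ltW.
have e3 : 0 < 1 + 2 * e by lra.
by rewrite -(ler_pM2r e3); exact: le_trans h1 h2.
Qed.

Lemma gibbs_unique (mu nu : probability X R) : gibbs_invariant mu ->
  gibbs_invariant nu -> forall A, measurable A -> nu A = mu A.
Proof.
suff le (mu' nu' : probability X R) : gibbs_invariant mu' -> gibbs_invariant nu' ->
    forall A, measurable A -> pr mu' A <= pr nu' A.
  move=> gmu gnu A mA; rewrite -!prE //; congr EFin; apply: le_anti.
  by rewrite !le.
move=> gmu gnu A mA; have [K K1 dK] := dominates_exists.
have e0 : 0 < K - 1 by rewrite subr_gt0.
have dn n : dominates (1 + (K - 1) / 2 ^+ n).
  elim: n => [|n IH]; first by rewrite expr0 divr1 addrC subrK.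
  rewrite exprS invfM mulrCA mulrC.
  by apply: dominates_improve => //; rewrite divr_gt0 // exprn_gt0.
have : (1 + geometric (K - 1) (2^-1) n) * pr nu' A @[n --> \oo] --> (1 + 0) * pr nu' A.
  apply: cvgMl; apply: cvgD; first exact: cvg_cst.
  by apply: cvg_geometric; rewrite ger0_norm ?invr_ge0 // invf_lt1 // ltr1n.
rewrite addr0 mul1r => h.
apply: ler_cvg_to (cvg_cst _) h _; apply: nearW => n.
by rewrite /geometric /= exprVn; exact: dn.
Qed.

End uniqueness.

(** * Existence *)

Section nested_intervals.
Variables (R : realType) (A : eqType) (a0 : A) (alph : seq A) (G : seq A -> R).
Hypotheses (alph_uniq : uniq alph) (G_ge0 : forall s, 0 <= G s).
Hypothesis G_nil : G [::] = 1.
Hypothesis G_rcons : forall s, \sum_(a <- alph) G (rcons s a) = G s.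

Let cum s i : R := \sum_(a <- take i alph) G (rcons s a).

Let cumS s i : (i < size alph)%N -> cum s i.+1 = cum s i + G (rcons s (nth a0 alph i)).
Proof. by move=> h; rewrite /cum (take_nth a0) // big_rcons /= addrC. Qed.

Let le_cum s i j : (i <= j)%N -> cum s i <= cum s j.
Proof.
move=> ij; rewrite /cum -[in leRHS](cat_take_drop i (take j alph)).
rewrite big_cat /= take_takel // lerDl; apply: sumr_ge0 => a _; exact: G_ge0.
Qed.

Let cum_size s : cum s (size alph) = G s.
Proof. by rewrite /cum take_size G_rcons. Qed.

(* The unit interval is cut into half-open intervals of lengths [G [:: a]], each of
   these into intervals of lengths [G [:: a; b]], and so on; [address n r] names the
   interval of level [n] around [r]. *)
Definition branch s (r : R) : nat := find (fun i => r < cum s i.+1) (iota 0 (size alph)).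

Let branchP s r : 0 <= r < G s ->
  [/\ (branch s r < size alph)%N, cum s (branch s r) <= r & r < cum s (branch s r).+1].
Proof.
move=> /andP[r0 rG].
have hh : has (fun i => r < cum s i.+1) (iota 0 (size alph)).
  apply/hasP; have n0 : (0 < size alph)%N.
    rewrite lt0n; apply/eqP => /size0nil e.
    by move: rG; rewrite -cum_size /cum e /= big_nil ltNge r0.
  by exists (size alph).-1; rewrite ?mem_iota ?prednK ?cum_size //= add0n.
have bs : (branch s r < size alph)%N by rewrite -[X in (_ < X)%N](size_iota 0) -has_find.
have := nth_find 0%N hh; rewrite -/(branch s r) nth_iota // add0n => h2.
split => //; rewrite leNgt; apply/negP => h1.
case E : (branch s r) => [|i] in h1 bs *.
  by move: h1; rewrite /cum take0 big_nil ltNge r0.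
have := @before_find _ 0%N (fun i => r < cum s i.+1) (iota 0 (size alph)) i.
by rewrite -/(branch s r) E ltnSn nth_iota ?add0n ?h1 1?ltnW // => /(_ erefl).
Qed.

Let branch_uniq s r i : 0 <= r < G s -> (i < size alph)%N ->
  cum s i <= r -> r < cum s i.+1 -> branch s r = i.
Proof.
move=> rG iA h1 h2; have [bA h3 h4] := branchP rG.
apply/eqP; rewrite eqn_leq; apply/andP; split; rewrite leqNgt; apply/negP => h.
  by have := lt_le_trans h2 (le_trans (le_cum s h) h3); rewrite ltxx.
by have := lt_le_trans h4 (le_trans (le_cum s h) h1); rewrite ltxx.
Qed.

(** The second component is the offset of [r] from the left end of the current interval. *)
Fixpoint walk (n : nat) (r : R) : seq A * R :=
  if n is n'.+1 then
    let: (s, r') := walk n' r in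
    (rcons s (nth a0 alph (branch s r')), r' - cum s (branch s r'))
  else ([::], r).

Definition address n r := (walk n r).1.

Let walkP n r : 0 <= r < 1 ->
  let: (s, r') := walk n r in [/\ size s = n, 0 <= r' < G s & all [in alph] s].
Proof.
move=> r01; elim: n => [|n] /=; first by rewrite G_nil.
case: walk => s r' [sn rG al]; have [bA h1 h2] := branchP rG.
rewrite size_rcons sn all_rcons al andbT mem_nth //; split=> //.
rewrite subr_ge0 h1 /= ltrBlDl; by rewrite cumS // in h2.
Qed.

Lemma size_address n r : size (address n r) = n.
Proof.
by rewrite /address; elim: n => //= n; case: walk => s r' /= <-; rewrite size_rcons.
Qed.

(** The intervals are half-open, so one of length [0] is empty and contains no [r]. *)
Lemma address_gt0 n r : 0 <= r < 1 -> 0 < G (address n r).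
Proof.
move=> /(walkP n); rewrite /address; case: walk => s r' /= [_ /andP[h1 h2] _].
exact: le_lt_trans h2.
Qed.

Lemma address_mem n r : 0 <= r < 1 -> all [in alph] (address n r).
Proof. by move=> /(walkP n); rewrite /address; case: walk => s r' /= []. Qed.

Lemma addressS n r : exists a, address n.+1 r = rcons (address n r) a.
Proof. by rewrite /address /=; case: walk => s r' /=; eexists. Qed.

Lemma address_interval s : all [in alph] s -> exists l, forall r,
  (0 <= r < 1 /\ address (size s) r = s) <-> l <= r < l + G s.
Proof.
(* The induction also needs the offset kept by [walk] and the inclusion of the interval in
   [[0, 1)]. *)
have [l' hl'] : exists l' : seq A -> R, forall s, all [in alph] s ->
  (0 <= l' s /\ l' s + G s <= 1) /\ forall r, 0 <= r < 1 ->
    (walk (size s) r = (s, r - l' s) /\ l' s <= r < l' s + G s) \/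
    (address (size s) r != s /\ ~~ (l' s <= r < l' s + G s)).
  suff h s' : exists l, all [in alph] s' -> (0 <= l /\ l + G s' <= 1) /\
      forall r, 0 <= r < 1 ->
      (walk (size s') r = (s', r - l) /\ l <= r < l + G s') \/
      (address (size s') r != s' /\ ~~ (l <= r < l + G s')).
    by have [l' hl'] := choice h; exists l'.
  elim/last_ind: s' => [|s' a [l IH]].
    exists 0; rewrite G_nil add0r; split=> // r r01.
    by left; rewrite subr0 /=.
  have [aA|/negPf aA] := boolP (a \in alph); last by exists 0; rewrite all_rcons /= aA.
  pose i := index a alph; have iA : (i < size alph)%N by rewrite index_mem.
  have ia : nth a0 alph i = a by rewrite nth_index.
  (* The interval of [rcons s' a] starts after those of the letters listed before [a]. *)
  exists (l + cum s' i); rewrite all_rcons => /andP[_ /IH [[l0 l1] hl]].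
  have ci0 : 0 <= cum s' i by apply: sumr_ge0 => *; exact: G_ge0.
  have ci1 : cum s' i.+1 <= G s' by rewrite -cum_size le_cum.
  have ciS : cum s' i.+1 = cum s' i + G (rcons s' a) by rewrite cumS // ia.
  split; first by split; [exact: addr_ge0|lra].
  move=> r r01; have [[w lr]|[w lr]] := hl r r01; rewrite size_rcons; last first.
    right; split.
      apply: contra w => /eqP; have [b ->] := addressS (size s') r.
      by move/rcons_inj => [-> _].
    apply: contra lr => /andP[h1 h2]; apply/andP; split; lra.
  have rG : 0 <= r - l < G s' by apply/andP; move/andP: lr => []; split; lra.
  have [bA b1 b2] := branchP rG.
  have [bi|bi] := eqVneq (branch s' (r - l)) i.
    left; rewrite /= w bi ia; split; first by congr (_, _); lra.
    by rewrite bi in b1 b2; apply/andP; split; lra.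
  right; split.
    rewrite /address /= w /=; apply: contra bi => /eqP/rcons_inj[e].
    by rewrite /i -e index_uniq.
  apply: contra bi => /andP[h1 h2]; apply/eqP/branch_uniq => //; lra.
move=> sA; exists (l' s) => r; have [[l0 l1] hl] := hl' s sA; split.
  by move=> [r01 ad]; have [[]//|[/eqP]] := hl r r01.
move=> lr; have r01 : 0 <= r < 1.
  by move/andP: lr => [h1 h2]; apply/andP; split; lra.
split => //; have [[w _]|[_]] := hl r r01; first by rewrite /address w.
by rewrite lr.
Qed.

End nested_intervals.

(** * Image of Lebesgue measure on the unit interval *)

Section unit_interval_image.
Context (R : realType) d (T : measurableType d) (f : measurableTypeR R -> T).
Hypothesis mf : measurable_fun setT f.

Definition unit_image (A : set T) : \bar R :=
  lebesgue_measure (`[0, 1[%classic `&` f @^-1` A).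

Let mpre A : measurable A -> measurable (`[0 : R, 1[%classic `&` f @^-1` A).
Proof.
move=> mA; apply: measurableI; first exact: measurable_itv.
by rewrite -[_ @^-1` _]setTI; exact: mf.
Qed.

Let unit_image0 : unit_image set0 = 0%E.
Proof. by rewrite /unit_image preimage_set0 setI0 measure0. Qed.

Let unit_image_ge0 A : (0 <= unit_image A)%E.
Proof. exact: measure_ge0. Qed.

Let unit_image_sigma_additive : semi_sigma_additive unit_image.
Proof.
move=> F mF tF mUF; rewrite /unit_image preimage_bigcup setI_bigcupr.
apply: measure_semi_sigma_additive.
- by move=> n; exact: mpre.
- apply/trivIsetP => i j _ _ ij; move/trivIsetP : tF => /(_ i j Logic.I Logic.I ij) e.
  apply/seteqP; split=> // x [[_ h1] [_ h2]].
  by have : (F i `&` F j) (f x) by []; rewrite e.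
- by apply: bigcupT_measurable => n; exact: mpre.
Qed.

HB.instance Definition _ := isMeasure.Build _ _ _ unit_image
  unit_image0 unit_image_ge0 unit_image_sigma_additive.

Let unit_imageT : unit_image setT = 1%E.
Proof.
by rewrite /unit_image preimage_setT setIT lebesgue_measure_itv /= lte_fin ltr01 sube0.
Qed.

HB.instance Definition _ := Measure_isProbability.Build _ _ _ unit_image unit_imageT.

Lemma unit_imageP : exists mu : probability T R, forall A, mu A = unit_image A.
Proof. by exists unit_image. Qed.

End unit_interval_image.

(** * Weights of words and the Parry measure *)

Section weights.
Variables (R : realType) (beta : R).
Hypothesis beta_gt1 : 1 < beta.

Let beta_gt0 : 0 < beta. Proof. exact: lt_trans beta_gt1. Qed.

Local Notation X := (beta_shift_borel beta).
Local Notation M := (Num.truncn beta).+1.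
Local Notation Ws := (words M).
Local Notation state := (state beta).
Local Notation step := (step beta).
Local Notation top := (top beta).
Local Notation cyl := (@cyl R beta).

(** The quasi-greedy orbit of [1], which never reaches [0]. *)
Definition orbit_top j : R := iter j top 1.

Lemma orbit_top01 j : 0 < orbit_top j <= 1.
Proof.
elim: j => [|j /andP[h _]]; first by rewrite /orbit_top /= ltr01 lexx.
by rewrite /orbit_top /= top_gt0 // top_le1.
Qed.

Definition wsum n (f : R -> R) : R := \sum_(0 <= j < n) beta^-1 ^+ j * f (orbit_top j).

Lemma wsumS n f : wsum n.+1 f = wsum n f + beta^-1 ^+ n * f (orbit_top n).
Proof. by rewrite /wsum big_nat_recr. Qed.

Lemma le_wsum n f g : (forall t, 0 < t <= 1 -> f t <= g t) -> wsum n f <= wsum n g.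
Proof.
move=> fg; apply: ler_sum => j _; rewrite ler_wpM2l ?exprn_ge0 ?invr_ge0 ?(ltW beta_gt0) //.
exact/fg/orbit_top01.
Qed.

Lemma wsum_cst_le n c : 0 <= c -> wsum n (fun=> c) <= beta / (beta - 1) * c.
Proof.
move=> c0; have -> : wsum n (fun=> c) = (1 - beta^-1 ^+ n) * (beta / (beta - 1)) * c.
  elim: n => [|n IH]; first by rewrite /wsum big_geq // expr0 subrr !mul0r.
  rewrite wsumS IH exprS; field; by rewrite subr_eq0 !gt_eqF.
rewrite ler_wpM2r // ler_piMl ?divr_ge0 ?subr_ge0 ?(ltW beta_gt0) ?(ltW beta_gt1) //.
by rewrite lerBlDr lerDl exprn_ge0 // invr_ge0 ltW.
Qed.

Definition psum w n : R := wsum n (fun t => state t w).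

Lemma psum_le w n : psum w n <= beta / (beta - 1) * state 1 w.
Proof.
apply: le_trans (wsum_cst_le _ _); last by rewrite state_ge0.
by apply: le_wsum => t /andP[_ t1]; exact: le_state.
Qed.

Lemma psum_nd w : nondecreasing_seq (psum w).
Proof.
apply/nondecreasing_seqP => n; rewrite /psum wsumS lerDl mulr_ge0 //.
  by rewrite exprn_ge0 // invr_ge0 ltW.
by apply: state_ge0; have /andP[/ltW] := orbit_top01 n.
Qed.

(** Up to the factor [beta^|w|], the integral of the unnormalised Parry density [sum_j beta^-j
    1_[0, t_j)], with [t_j = orbit_top j], over the numbers whose digits begin with [w]. *)
Definition weight w : R := limn (psum w).

Lemma weight_cvg w : psum w n @[n --> \oo] --> weight w.
Proof.
apply: nondecreasing_is_cvgn; first exact: psum_nd.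
by exists (beta / (beta - 1) * state 1 w) => _ [n _ <-]; exact: psum_le.
Qed.

Lemma weight_le w : weight w <= beta / (beta - 1) * state 1 w.
Proof.
by apply: limr_le; [exact: weight_cvg|apply: nearW => n; exact: psum_le].
Qed.

Lemma weight_ge w : state 1 w <= weight w.
Proof.
apply: limr_ge; first exact: weight_cvg.
exists 1%N => // n /= n1; apply: le_trans (psum_nd w n1).
by rewrite /psum /wsum big_nat1 mul1r.
Qed.

Lemma weight_gt0 w : (0 < weight w) = (0 < state 1 w).
Proof.
apply/idP/idP => h; last exact: lt_le_trans (weight_ge _).
have := lt_le_trans h (weight_le w).
by rewrite pmulr_rgt0 // divr_gt0 // subr_gt0.
Qed.

Lemma weight_ge0 w : 0 <= weight w.
Proof. by apply: le_trans (weight_ge _); exact: state_ge0. Qed.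

Lemma cvg_sum_ord (I : Type) (s : seq I) (F : I -> nat -> R) (l : I -> R) :
  (forall i, F i n @[n --> \oo] --> l i) ->
  \sum_(i <- s) F i n @[n --> \oo] --> \sum_(i <- s) l i.
Proof.
move=> h; elim: s => [|i s IH].
  rewrite big_nil; under eq_fun do rewrite big_nil; exact: cvg_cst.
rewrite big_cons; under eq_fun do rewrite big_cons.
exact: cvgD.
Qed.

Lemma weight_rcons w : \sum_(a <- iota 0 M) weight (rcons w a) = beta * weight w.
Proof.
have h1 := cvg_sum_ord (s := iota 0 M) (fun a => @weight_cvg (rcons w a)).
have h2 : beta * psum w n @[n --> \oo] --> beta * weight w.
  by apply: cvgMr; exact: weight_cvg.
have e : (fun n => \sum_(a <- iota 0 M) psum (rcons w a) n) = (fun n => beta * psum w n).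
  apply/funext => n; rewrite /psum /wsum exchange_big mulr_sumr /=; apply: eq_bigr => j _.
  have /andP[t0 t1] := orbit_top01 j.
  rewrite -mulr_sumr mulrCA -(@sum_step_id _ _ beta_gt1 (state (orbit_top j) w));
    last by rewrite state_ge0 ?state_le1 ?(ltW t0).
  rewrite -(big_mkord xpredT (fun a => step (state (orbit_top j) w) a)).
  by rewrite /index_iota subn0; congr (_ * _); apply: eq_bigr => a _; rewrite state_rcons.
by rewrite e in h1; exact: (cvg_unique _ h1 h2).
Qed.

(** A first digit sends [t_j] to [1] in [beta t_j - t_(j+1)] cases and to [t_(j+1)] once. The latter
    shifts the sum by one index; the coefficients of [state 1 w] telescope to the missing term of
    index [0] minus a remainder. *)
Lemma psum_cons w n : \sum_(a <- iota 0 M) psum (a :: w) n =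
  beta * psum w n.+1 - beta * beta^-1 ^+ n * orbit_top n * state 1 w.
Proof.
elim: n => [|n IH].
  rewrite big1 => [|a _]; last by rewrite /psum /wsum big_geq.
  by rewrite /psum /wsum big_nat1 expr0 !mulr1 mul1r subrr.
rewrite /psum; under eq_bigr do rewrite wsumS.
rewrite big_split /= IH -mulr_sumr.
have := @sum_step _ _ beta_gt1 (state ^~ w) (orbit_top n) (state0 _ _) (orbit_top01 n).
rewrite -(big_mkord xpredT (fun a => state (step (orbit_top n) a) w)).
rewrite /index_iota subn0 => ->.
rewrite (wsumS n.+1) -/(psum w n.+1) exprS -[orbit_top n.+1]/(top (orbit_top n)).
have -> : (maxdigit beta (orbit_top n))%:R = beta * orbit_top n - top (orbit_top n).
  by rewrite /top opprB addrC subrK.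
by field; rewrite gt_eqF.
Qed.

(** The remainder in [psum_cons] tends to [0], since [orbit_top n] is at most [1]. *)
Lemma weight_cons w : \sum_(a <- iota 0 M) weight (a :: w) = beta * weight w.
Proof.
have h1 := cvg_sum_ord (s := iota 0 M) (fun a => @weight_cvg (a :: w)).
have e : (fun n => \sum_(a <- iota 0 M) psum (a :: w) n) =
    (fun n => beta * psum w n.+1 - beta * beta^-1 ^+ n * orbit_top n * state 1 w).
  by apply/funext => n; rewrite psum_cons.
suff h2 : beta * psum w n.+1 - beta * beta^-1 ^+ n * orbit_top n * state 1 w
    @[n --> \oo] --> beta * weight w by rewrite e in h1; exact: (cvg_unique _ h1 h2).
rewrite -[X in _ --> X]subr0; apply: cvgB.
  by apply: cvgMr; rewrite (cvg_shiftS (psum w)); exact: weight_cvg.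
rewrite -(mul0r (state 1 w)); apply: cvgMl.
have e0 : beta * beta^-1 ^+ n @[n --> \oo] --> (0 : R^o).
  apply: (@cvg_geometric _ beta).
  by rewrite ger0_norm ?invr_ge0 ?ltW // invf_lt1.
apply: (squeeze_cvgr _ (cvg_cst 0) e0); apply: nearW => n.
have /andP[t0 t1] := orbit_top01 n.
have b0 : 0 <= beta * beta^-1 ^+ n by rewrite mulr_ge0 ?exprn_ge0 ?invr_ge0 ?(ltW beta_gt0).
by rewrite mulr_ge0 ?(ltW t0) //= ler_piMr.
Qed.

(* A sequence of pairs codes the window [-N, N) from the centre outwards: the
   [i]-th pair holds the digits at [-i-1] and [i]. *)
Definition spread (s : seq (nat * nat)) : seq nat :=
  rev [seq p.1 | p <- s] ++ [seq p.2 | p <- s].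

Lemma size_spread s : size (spread s) = (size s + size s)%N.
Proof. by rewrite size_cat size_rev !size_map. Qed.

Lemma spread_rcons s p : spread (rcons s p) = p.1 :: rcons (spread s) p.2.
Proof. by rewrite /spread !map_rcons rev_rcons /= rcons_cat. Qed.

Lemma spread_inj s s' : spread s = spread s' -> s = s'.
Proof.
elim/last_ind: s s' => [|s p IH] s'; case/lastP: s' => [|s' p'] //.
- by move/(congr1 size); rewrite !size_spread size_rcons addSn.
- by move/(congr1 size); rewrite !size_spread size_rcons addSn.
rewrite !spread_rcons; case: p p' => a b [a' b'] /= [-> /rcons_inj [/IH -> ->]].
by [].
Qed.

Definition pairs : seq (nat * nat) := [seq (a, b) | a <- iota 0 M, b <- iota 0 M].

Lemma spread_surj N w : w \in Ws (N + N) ->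
  exists s, [/\ size s = N, all [in pairs] s & spread s = w].
Proof.
elim: N w => [|N IH] w; first by rewrite addn0 inE => /eqP ->; exists [::].
rewrite addSn addnS mem_words => /andP[/eqP sw aw].
case: w sw aw => // a w; case/lastP: w => // w b.
rewrite /= size_rcons all_rcons => -[sw] /and3P[aM bM wM].
have [|s [sN sp <-]] := IH w; first by rewrite mem_words sw eqxx.
exists (rcons s (a, b)); rewrite size_rcons sN all_rcons sp andbT spread_rcons.
split=> //; apply/allpairsP; exists (a, b); split => //; by rewrite mem_iota.
Qed.

Definition mass (s : seq (nat * nat)) : R :=
  weight (spread s) / (beta ^+ (size s + size s) * weight [::]).

Let w0 : 0 < weight [::].
Proof. by rewrite weight_gt0 ltr01. Qed.

Lemma mass_ge0 s : 0 <= mass s.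
Proof. by rewrite divr_ge0 ?weight_ge0 // mulr_ge0 ?exprn_ge0 ?weight_ge0 1?ltW. Qed.

Lemma mass_gt0 s : (0 < mass s) = (0 < state 1 (spread s)).
Proof. by rewrite pmulr_lgt0 ?weight_gt0 // invr_gt0 mulr_gt0 ?exprn_gt0. Qed.

Lemma mass_nil : mass [::] = 1.
Proof. by rewrite /mass /spread /= expr0 mul1r divff // gt_eqF. Qed.

(** One more pair adds a digit at each end, and each end contributes a factor [beta]. *)
Lemma mass_rcons s : \sum_(p <- pairs) mass (rcons s p) = mass s.
Proof.
have -> : \sum_(p <- pairs) mass (rcons s p) = \sum_(a <- iota 0 M) \sum_(b <- iota 0 M)
    weight (rcons (a :: spread s) b) / (beta ^+ (size s).+1 * beta ^+ (size s).+1 * weight [::]).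
  rewrite big_allpairs_dep; apply: eq_bigr => a _; apply: eq_bigr => b _.
  by rewrite /mass spread_rcons size_rcons exprD.
under eq_bigr do rewrite -mulr_suml weight_rcons.
rewrite -mulr_suml -mulr_sumr weight_cons /mass exprD !exprS.
by field; rewrite !gt_eqF // exprn_gt0.
Qed.

Lemma pairs_uniq : uniq pairs.
Proof. by apply: allpairs_uniq; rewrite ?iota_uniq // => -[a b] [c d] _ _ /= [-> ->]. Qed.

Local Notation address := (address (0%N, 0%N) pairs mass).

Lemma nth_address n i r : (i < n)%N ->
  nth (0%N, 0%N) (address n r) i = nth (0%N, 0%N) (address i.+1 r) i.
Proof.
elim: n => // n IH; rewrite ltnS leq_eqVlt => /orP[/eqP -> //|iN].
have [a ->] := addressS (0%N, 0%N) pairs mass n r.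
by rewrite nth_rcons size_address iN IH.
Qed.

Definition address_seq (r : R) (k : int) : nat :=
  match k with
  | Posz n => (nth (0%N, 0%N) (address n.+1 r) n).2
  | Negz n => (nth (0%N, 0%N) (address n.+1 r) n).1
  end.

Lemma word_address_seq N r : word (- N%:Z) (N + N) (address_seq r) = spread (address N r).
Proof.
apply: (@eq_from_nth _ 0%N); rewrite size_word ?size_spread ?size_address // => i iN.
rewrite nth_word // nth_cat size_rev size_map size_address; case: ltnP => h.
  rewrite nth_rev ?size_map ?size_address // (nth_map (0%N, 0%N)) ?size_address; last by lia.
  rewrite nth_address; last by lia.
  by rewrite (_ : - N%:Z + i%:Z = Negz (N - i.+1)) //; lia.
rewrite (nth_map (0%N, 0%N)) ?size_address; last by lia.
rewrite nth_address; last by lia.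
by rewrite (_ : - N%:Z + i%:Z = Posz (i - N)) //; lia.
Qed.

Lemma address_seq_allowed r : 0 <= r < 1 -> allowed beta (address_seq r).
Proof.
move=> r01; apply: (allowedP beta_gt1) => j; exists (- j%:Z), (j + j)%N; split; [lia|lia|].
rewrite word_address_seq -mass_gt0.
by apply: address_gt0 => //; [exact: mass_nil|exact: mass_rcons].
Qed.

Definition address_point (r : R) : X :=
  if pselect (0 <= r < 1 /\ exists y : X, coord y = address_seq r) is left h
  then sval (cid h.2) else point.

Lemma coord_address_point r : 0 <= r < 1 -> coord (address_point r) = address_seq r.
Proof.
move=> r01; rewrite /address_point; case: pselect => [h|]; first by case: cid.
by case; split=> //; exact/(coord_surj beta_gt1)/address_seq_allowed.
Qed.

Lemma address_point_out r : ~ (0 <= r < 1) -> address_point r = point.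
Proof. by rewrite /address_point; case: pselect => // -[]. Qed.

Lemma address_set s : all [in pairs] s ->
  exists l, [set r | 0 <= r < 1 /\ address (size s) r = s] = `[l, (l + mass s)[%classic.
Proof.
move=> sp; have [l hl] := address_interval (0%N, 0%N) pairs_uniq mass_ge0 mass_nil mass_rcons sp.
exists l; apply/seteqP; split=> r /=; rewrite in_itv /=; exact: (hl r).1 || exact: (hl r).2.
Qed.

(** The preimage of a window set is a countable union of intervals, together with the complement of
    [[0, 1)] if the default point belongs to the set. *)
Lemma measurable_address_point : measurable_fun [set: measurableTypeR R] address_point.
Proof.
apply: (@measurability _ _ (measurableTypeR R) X setT _ (@csets R beta)).
  exact: measurable_csets.
move=> _ [_ [N [P ->]] <-]; rewrite setTI.
rewrite (_ : _ @^-1` _ =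
  (\bigcup_(s in [set s | [/\ size s = N, all [in pairs] s & P (spread s)]])
    [set r : R | 0 <= r < 1 /\ address (size s) r = s])
  `|` (~` `[0, 1[%classic `&` [set r | cset N P (point : X)])).
  apply: measurableU.
    rewrite bigcup_mkcond; apply: countable_bigcupT_measurable => [|s].
      exact: (@countableP (seq (nat * nat))).
    case: ifPn => // /set_mem [_ sp _].
    by have [l ->] := address_set sp; exact: measurable_itv.
  apply: measurableI; first by apply: measurableC; exact: measurable_itv.
  have [h|h] := pselect (cset N P (point : X)).
    by rewrite (_ : [set _ | _] = setT) //; apply/seteqP; split.
  by rewrite (_ : [set _ | _] = set0) //; apply/seteqP; split.
apply/seteqP; split=> r.
  have [r01|r01] := pselect (0 <= r < 1).
    rewrite /cset /= coord_address_point // word_address_seq => Pr; left.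
    exists (address N r); rewrite /= ?size_address //; split => //.
    by apply: address_mem => //; [exact: mass_nil|exact: mass_rcons].
  by rewrite /= address_point_out // => h; right; split => //=.
case=> [[s [sN sp Ps] [r01 rs]]|[r01 h]].
  by rewrite /cset /= coord_address_point // word_address_seq -sN rs.
by rewrite /= address_point_out //; move: r01; rewrite /= in_itv.
Qed.

Lemma parry_measure : exists mu : probability X R, forall N w, w \in Ws (N + N) ->
  pr mu (cyl (- N%:Z) w) = weight w / (beta ^+ (N + N) * weight [::]).
Proof.
have [mu hmu] := unit_imageP measurable_address_point.
exists mu => N w wN; have [s [sN sp sw]] := spread_surj wN.
rewrite /pr hmu /unit_image.
rewrite (_ : _ `&` _ = [set r : R | 0 <= r < 1 /\ address (size s) r = s]).
  have [l ->] := address_set sp; rewrite lebesgue_measure_itv /= lte_fin ltrDl.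
  (* A word of mass [0] has an empty interval. *)
  case: ltP => m0; first by rewrite -EFinD addrAC subrr add0r /= /mass sw sN.
  have -> : weight w = 0; last by rewrite mul0r.
  apply: le_anti; rewrite weight_ge0 andbT leNgt weight_gt0 -sw -mass_gt0 -leNgt //.
apply/seteqP; split=> r /=; rewrite in_itv /=.
  move=> [r01]; rewrite /cyl /= coord_address_point // (size_words wN).
  by rewrite word_address_seq -sw sN => /spread_inj.
move=> [r01 rs]; split => //; rewrite /cyl /= coord_address_point // (size_words wN).
by rewrite word_address_seq -sN rs.
Qed.

End weights.

(** * Effect on the weights of exchanging a middle word *)

Section boundary_words.
Variables (R : realType) (beta : R).
Hypothesis beta_gt1 : 1 < beta.

Let beta_gt0 : 0 < beta. Proof. exact: lt_trans beta_gt1. Qed.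

Local Notation M := (Num.truncn beta).+1.
Local Notation Ws := (words M).
Local Notation state := (state beta).
Local Notation step := (step beta).

(** Only states reached after at least one letter count: starting in state [1] is not a reset. *)
Fixpoint resets (t : R) (w : seq nat) : bool :=
  if w is a :: w' then (step t a == 1) || resets (step t a) w' else false.

(** The run from [1] stays above the run from [t], so it is at [1] when the latter is, and the two
    agree from then on. *)
Lemma resets_state t w : t <= 1 -> resets t w -> state t w = state 1 w.
Proof.
elim: w t => //= a w IH t t1 /orP[/eqP h|h].
  rewrite h; congr state; apply: le_anti; rewrite step_le1 andbT -[in leLHS]h.
  exact: le_step.
have h1 := IH _ (step_le1 _ _ _) h; apply: le_anti; apply/andP; split.
  by apply: le_state => //; exact: le_step.
by rewrite h1; apply: le_state => //; exact: step_le1.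
Qed.

Definition lingers t w : R := ((0 < state t w) && ~~ resets t w)%:R.

Lemma lingers_ge0 t w : 0 <= lingers t w.
Proof. by rewrite /lingers ler0n. Qed.

(* From a given state, the only word that never resets follows the maximal digit. *)
Lemma sum_lingers n t : 0 <= t <= 1 -> \sum_(w <- Ws n) lingers t w <= 1.
Proof.
elim: n t => [|n IH] t t01.
  by rewrite big_seq1 /lingers /= andbT lern1 leq_b1.
rewrite sum_words_cons.
have /andP[+ t1] := t01; rewrite le_eqVlt => /orP[/eqP t0|t0].
  rewrite big1 // => a _; rewrite big1 // => w _.
  by rewrite /lingers -t0 state0 ltxx.
pose f s : R := if s == 1 then 0 else \sum_(w <- Ws n) lingers s w.
have -> : \sum_(a < M) \sum_(w <- Ws n) lingers t (val a :: w) =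
    \sum_(a < M) f (step t a).
  apply: eq_bigr => a _; rewrite /f; case: ifP => e.
    by rewrite big1 // => w _; rewrite /lingers /= e andbF.
  by apply: eq_bigr => w _; rewrite /lingers /= e.
have f0 : f 0 = 0.
  rewrite /f; case: ifP => // _; rewrite big1 // => w _.
  by rewrite /lingers state0 ltxx.
rewrite (sum_step beta_gt1 f0) ?t0 // {1}/f eqxx mulr0 add0r /f.
case: ifP => // _; apply: IH.
by rewrite (ltW (top_gt0 beta_gt1 t0)) top_le1.
Qed.

Definition admissible w : R := (0 < state 1 w)%R%:R.

Lemma admissible_ge0 w : 0 <= admissible w. Proof. by rewrite /admissible ler0n. Qed.

(* If [p] resets from [s], the prefix state is forgotten; if moreover [q] resets after
   both [p ++ u] and [p ++ v], the middle word is forgotten too. *)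
Lemma state_swap_le s p u v q : 0 < s <= 1 ->
  0 < state 1 (p ++ u ++ q) -> 0 < state 1 (p ++ v ++ q) ->
  `|state s (p ++ u ++ q) - state s (p ++ v ++ q)| <=
  lingers s p * admissible q +
  admissible p * (lingers (state 1 (p ++ u)) q + lingers (state 1 (p ++ v)) q).
Proof.
move=> /andP[s0 s1] au av.
have ap : admissible p = 1 by rewrite /admissible (state_gt0_prefix (ltW ltr01) au).
have aq : admissible q = 1.
  by move: au; rewrite catA /admissible => /state_gt0_suffix ->.
rewrite ap aq mulr1 mul1r.
have le1 x y : 0 <= x <= 1 -> 0 <= y <= 1 -> `|x - y| <= (1 : R).
  by move=> /andP[? ?] /andP[? ?]; rewrite ler_norml; apply/andP; split; lra.
have st01 w : 0 <= state s w <= 1 by rewrite state_ge0 ?state_le1 // ltW.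
have [rp|rp] := boolP (resets s p); last first.
  have [sp|sp] := boolP (0 < state s p).
    apply: le_trans (le1 _ _ (st01 _) (st01 _)) _.
    by rewrite {1}/lingers sp rp lerDl addr_ge0 // lingers_ge0.
  have e0 : state s p = 0 by apply: le_anti; rewrite leNgt sp state_ge0 // ltW.
  rewrite !state_cat e0 !state0 subrr normr0 !addr_ge0 ?lingers_ge0 //.
have ep : state s p = state 1 p by exact: resets_state.
have eu : state s (p ++ u ++ q) = state (state 1 (p ++ u)) q by rewrite !state_cat ep.
have ev : state s (p ++ v ++ q) = state (state 1 (p ++ v)) q by rewrite !state_cat ep.
have qu : 0 < state (state 1 (p ++ u)) q by rewrite -state_cat -catA.
have qv : 0 < state (state 1 (p ++ v)) q by rewrite -state_cat -catA.
have [ru|ru] := boolP (resets (state 1 (p ++ u)) q); last first.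
  apply: le_trans (le1 _ _ (st01 _) (st01 _)) _.
  by rewrite {2}/lingers qu ru [leRHS]addrCA lerDl addr_ge0 // lingers_ge0.
have [rv|rv] := boolP (resets (state 1 (p ++ v)) q); last first.
  apply: le_trans (le1 _ _ (st01 _) (st01 _)) _.
  by rewrite {3}/lingers qv rv addrA lerDr addr_ge0 // lingers_ge0.
rewrite eu ev (resets_state _ ru) ?(resets_state _ rv) ?state_le1 //.
by rewrite subrr normr0 !addr_ge0 ?lingers_ge0.
Qed.

(** In each of the three terms of [state_swap_le] the [lingers] factor sums to at most [1] and the
    [admissible] factor to [nadm beta L 1]. The total is of order [beta^L], although there are of
    order [beta^(2 L)] pairs of admissible words. *)
Lemma sum_state_swap_le s L u v : 0 < s <= 1 ->
  \sum_(p <- Ws L) \sum_(q <- Ws L)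
    admissible (p ++ u ++ q) * admissible (p ++ v ++ q) *
    `|state s (p ++ u ++ q) - state s (p ++ v ++ q)| <= 3 * nadm beta L 1.
Proof.
move=> s01.
have le1 p : 0 <= state 1 p <= 1 by rewrite state_ge0 // state_le1.
apply: (@le_trans _ _ (\sum_(p <- Ws L) \sum_(q <- Ws L)
  (lingers s p * admissible q +
   admissible p * (lingers (state 1 (p ++ u)) q + lingers (state 1 (p ++ v)) q)))).
  apply: ler_sum => p _; apply: ler_sum => q _.
  have n0 : 0 <= lingers s p * admissible q + admissible p *
      (lingers (state 1 (p ++ u)) q + lingers (state 1 (p ++ v)) q).
    by rewrite addr_ge0 // mulr_ge0 ?addr_ge0 ?lingers_ge0 ?admissible_ge0.
  rewrite {1 2}/admissible.
  have [au|_] := boolP (0 < state 1 (p ++ u ++ q)); last by rewrite !mul0r.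
  have [av|_] := boolP (0 < state 1 (p ++ v ++ q)); last by rewrite mulr0 mul0r.
  by rewrite !mul1r; exact: state_swap_le.
have -> : 3 * nadm beta L 1 = nadm beta L 1 + 2 * nadm beta L 1 by ring.
under eq_bigr do rewrite big_split -mulr_sumr -mulr_sumr big_split /=.
rewrite big_split /= -mulr_suml; apply: lerD.
  rewrite ler_piMl ?nadm_ge0 //; apply: sum_lingers.
  by case/andP: s01 => /ltW -> ->.
rewrite mulrC /nadm mulr_suml; apply: ler_sum => p _.
by rewrite ler_wpM2l ?admissible_ge0 // (_ : 2 = 1 + 1) // lerD // sum_lingers.
Qed.

(** A weight combines the states started at [orbit_top j] with coefficients [beta^-j], whose partial
    sums are at most [beta / (beta - 1)]. *)
Lemma sum_weight_swap_le L u v :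
  \sum_(p <- Ws L) \sum_(q <- Ws L)
    admissible (p ++ u ++ q) * admissible (p ++ v ++ q) *
    `|weight beta (p ++ u ++ q) - weight beta (p ++ v ++ q)| <=
  beta / (beta - 1) * (3 * nadm beta L 1).
Proof.
pose F n := \sum_(p <- Ws L) \sum_(q <- Ws L)
    admissible (p ++ u ++ q) * admissible (p ++ v ++ q) *
    `|psum beta (p ++ u ++ q) n - psum beta (p ++ v ++ q) n|.
have cF : F n @[n --> \oo] --> \sum_(p <- Ws L) \sum_(q <- Ws L)
    admissible (p ++ u ++ q) * admissible (p ++ v ++ q) *
    `|weight beta (p ++ u ++ q) - weight beta (p ++ v ++ q)|.
  apply: (cvg_sum_ord (F := fun p n => \sum_(q <- Ws L)
    admissible (p ++ u ++ q) * admissible (p ++ v ++ q) *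
    `|psum beta (p ++ u ++ q) n - psum beta (p ++ v ++ q) n|)) => p.
  apply: (cvg_sum_ord (F := fun q n =>
    admissible (p ++ u ++ q) * admissible (p ++ v ++ q) *
    `|psum beta (p ++ u ++ q) n - psum beta (p ++ v ++ q) n|)) => q.
  by apply: cvgMr; apply: cvg_norm; apply: cvgB; exact: weight_cvg.
apply: (ler_cvg_to cF (cvg_cst _)); apply: nearW => n.
apply: le_trans (wsum_cst_le beta_gt1 n _); last by rewrite mulr_ge0 ?nadm_ge0.
apply: (@le_trans _ _ (wsum beta n (fun s => \sum_(p <- Ws L) \sum_(q <- Ws L)
    admissible (p ++ u ++ q) * admissible (p ++ v ++ q) *
    `|state s (p ++ u ++ q) - state s (p ++ v ++ q)|))); last first.
  by apply: le_wsum => // s s01; exact: sum_state_swap_le.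
rewrite /F /wsum; under [leRHS]eq_bigr do rewrite mulr_sumr.
rewrite [leRHS]exchange_big; apply: ler_sum => p _ /=.
under [leRHS]eq_bigr do rewrite mulr_sumr.
rewrite [leRHS]exchange_big; apply: ler_sum => q _ /=.
rewrite /psum /wsum -sumrB.
under [leRHS]eq_bigr do rewrite mulrCA.
rewrite -mulr_sumr ler_wpM2l ?mulr_ge0 ?admissible_ge0 //.
apply: le_trans (ler_norm_sum _ _ _) _; apply: ler_sum => j _.
rewrite -mulrBr normrM ger0_norm // exprn_ge0 // invr_ge0 ltW //.
Qed.

End boundary_words.

(** * Gibbs invariance of the Parry measure *)

Section invariance.
Variables (R : realType) (beta : R).
Hypothesis beta_gt1 : 1 < beta.

Let beta_gt0 : 0 < beta. Proof. exact: lt_trans beta_gt1. Qed.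

Local Notation X := (beta_shift_borel beta).
Local Notation M := (Num.truncn beta).+1.
Local Notation Ws := (words M).
Local Notation state := (state beta).
Local Notation cyl := (@cyl R beta).
Local Notation subst := (@subst R beta).
Local Notation substable := (@substable R beta).
Local Notation weight := (weight beta).

Variable mu : probability X R.
Hypothesis mu_cyl : forall N w, w \in Ws (N + N) ->
  pr mu (cyl (- N%:Z) w) = weight w / (beta ^+ (N + N) * weight [::]).

Let weight_nil_gt0 : 0 < weight [::]. Proof. by rewrite weight_gt0 // ltr01. Qed.

Lemma words_of_admissible n w : size w = n -> 0 < state 1 w -> w \in Ws n.
Proof.
elim/last_ind: w n => [|w a IH] n; first by move=> <-; rewrite inE.
rewrite size_rcons -cats1 => <- aw; have pw := state_gt0_prefix ler01 aw.
rewrite -(addn1 (size w)); apply: words_cat; first exact: IH.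
move: aw; rewrite mem_words state_cat /= step_gt0 => h.
rewrite andbT ltnS truncn_ge_nat ?(ltW beta_gt0) //.
by apply: le_trans (ltW h) _; rewrite ger_pMr // state_le1.
Qed.

Lemma pr_cyl_weight N w : size w = (N + N)%N ->
  pr mu (cyl (- N%:Z) w) = weight w / (beta ^+ (N + N) * weight [::]).
Proof.
move=> sw; have [h|h] := boolP (0 < state 1 w).
  by apply: mu_cyl; exact: words_of_admissible.
rewrite cyl_eq0 // pr0 (_ : weight w = 0) ?mul0r //.
by apply: le_anti; rewrite weight_ge0 // andbT leNgt weight_gt0.
Qed.

Section swap.
Variables (N : nat) (u v : seq nat).
Hypotheses (su : size u = (N + N)%N) (sv : size v = (N + N)%N).

Lemma word_repl_cyl L p q (b : seq nat) x : size b = (N + N)%N ->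
  size p = L -> size q = L ->
  cyl (- (N + L)%N%:Z) (p ++ b ++ q) x ->
  forall c, size c = (N + N)%N ->
  word (- (N + L)%N%:Z) ((N + L) + (N + L)) (repl (- N%:Z) c (coord x)) = p ++ c ++ q.
Proof.
move=> sb sp sq; rewrite !cyl_cat => -[cp [_ cq]] c sc.
have -> : ((N + L) + (N + L) = L + (size c + L))%N by lia.
rewrite word_cat (word_cat _ (size c)) word_repl_out; last by lia.
rewrite (_ : - _ + L%:Z = - N%:Z); last by lia.
rewrite word_repl word_repl_out; last by lia.
congr (_ ++ (_ ++ _)); first by rewrite -cp sp.
rewrite (_ : _ + _ = - (N + L)%N%:Z + (size p)%:Z + (size b)%:Z); last by lia.
by move: cq; rewrite /cyl /= sq.
Qed.

Section approximation.
Variables (K0 : nat) (Q : (int -> nat) -> Prop).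
Hypothesis dQ : forall s s',
  word (- K0%:Z) (K0 + K0) s = word (- K0%:Z) (K0 + K0) s' -> Q s -> Q s'.

(** [B L] and [B' L] are outer approximations of the two sets in [pr_swap_determined]: the replaced
    sequence is tested only on the window of radius [N + L], so that a finite window decides
    membership. *)
Let B L : set X := [set x | [/\ cyl (- N%:Z) u x,
  0 < state 1 (word (- (N + L)%N%:Z) ((N + L) + (N + L)) (repl (- N%:Z) v (coord x)))
  & Q (coord x)]].

Let B' L : set X := [set x | [/\ cyl (- N%:Z) v x,
  0 < state 1 (word (- (N + L)%N%:Z) ((N + L) + (N + L)) (repl (- N%:Z) u (coord x)))
  & Q (repl (- N%:Z) u (coord x))]].

Let determined_BQ (b c : seq nat) L (P : (int -> nat) -> Prop) :
  (forall s s', word (- K0%:Z) (K0 + K0) s = word (- K0%:Z) (K0 + K0) s' -> P s -> P s') ->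
  measurable ([set x | [/\ cyl (- N%:Z) b x,
  0 < state 1 (word (- (N + L)%N%:Z) ((N + L) + (N + L)) (repl (- N%:Z) c (coord x)))
  & P (coord x)]] : set X).
Proof.
move=> dP; rewrite (_ : [set _ | _] = cyl (- N%:Z) b `&` [set x |
   0 < state 1 (word (- (N + L)%N%:Z) ((N + L) + (N + L)) (repl (- N%:Z) c (coord x)))]
   `&` [set x | P (coord x)]); last first.
  by apply/seteqP; split=> x; [case|case=> -[]].
apply: measurableI; [apply: measurableI|].
- exact: measurable_cyl.
- apply: (@determined_repl _ _ _ _ (fun s => 0 < state 1 (word _ _ s))
    (- (N + L)%N%:Z) ((N + L) + (N + L))) => s s' ->; by [].
- by apply: (@measurable_determined _ _ (- K0%:Z) (K0 + K0)) => x y e; exact: dP.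
Qed.

Let dQu s s' : word (- K0%:Z) (K0 + K0) s = word (- K0%:Z) (K0 + K0) s' ->
  Q (repl (- N%:Z) u s) -> Q (repl (- N%:Z) u s').
Proof.
move=> e; apply: dQ; apply: eq_word => i ni; rewrite /repl; case: ifP => // _.
by rewrite -!(nth_word _ _ ni) e.
Qed.

Let mB L : measurable (B L). Proof. exact: determined_BQ. Qed.

Let mB' L : measurable (B' L).
Proof. exact: (@determined_BQ _ _ _ (fun s => Q (repl (- N%:Z) u s))). Qed.

Let pr_split (A : set X) b L : measurable A -> size b = (N + N)%N ->
  A `<=` cyl (- N%:Z) b -> pr mu A =
  \sum_(p <- Ws L) \sum_(q <- Ws L) pr mu (A `&` cyl (- (N + L)%N%:Z) (p ++ b ++ q)).
Proof.
move=> mA sb Ab; rewrite -(pr_cyl_split beta_gt1 mu mA L (m := - N%:Z)).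
  by rewrite (setIidl Ab).
lia.
Qed.

Let pr_diff_le L : (K0 <= N + L)%N -> `|pr mu (B L) - pr mu (B' L)| <=
  \sum_(p <- Ws L) \sum_(q <- Ws L)
    admissible beta (p ++ u ++ q) * admissible beta (p ++ v ++ q) *
    `|weight (p ++ u ++ q) - weight (p ++ v ++ q)| /
  (beta ^+ ((N + L) + (N + L)) * weight [::]).
Proof.
move=> K0L; rewrite (pr_split L (mB L) su) => [|x []//].
rewrite (pr_split L (mB' L) sv) => [|x []//].
have dK s s' : word (- (N + L)%N%:Z) ((N + L) + (N + L)) s =
    word (- (N + L)%N%:Z) ((N + L) + (N + L)) s' -> Q s -> Q s'.
  by move=> e; apply: dQ; apply: eq_word_sub e; lia.
set m := - (N + L)%N%:Z in dK *; set n := ((N + L) + (N + L))%N in dK *.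
rewrite -sumrB; apply: le_trans (ler_norm_sum _ _ _) _.
rewrite big_seq [leRHS]big_seq; apply: ler_sum => p /size_words sp.
rewrite -sumrB; apply: le_trans (ler_norm_sum _ _ _) _.
rewrite big_seq [leRHS]big_seq; apply: ler_sum => q /size_words sq.
have spb b : size b = (N + N)%N -> size (p ++ b ++ q) = n.
  by move=> sb; rewrite !size_cat sp sq sb /n; lia.
(* [c] depends on [p] and [q] only. If it holds, [B L] contains the cylinder of [p ++ u ++ q] and
   [B' L] that of [p ++ v ++ q]; if not, each is disjoint from that cylinder. *)
pose c := [/\ 0 < state 1 (p ++ u ++ q), 0 < state 1 (p ++ v ++ q) &
  exists2 s, word m n s = p ++ u ++ q & Q s].
have wx b x : size b = (N + N)%N -> cyl m (p ++ b ++ q) x ->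
    word m n (coord x) = p ++ b ++ q.
  by move=> sb; rewrite /cyl /= spb.
have Bc x : (B L `&` cyl m (p ++ u ++ q)) x -> c.
  move=> [[_ + Qx] cx]; rewrite -/m -/n (word_repl_cyl su sp sq cx sv) => av.
  split => //; first by rewrite -(wx _ _ su cx); exact: coord_allowed.
  by exists (coord x); first exact: wx.
have B'c x : (B' L `&` cyl m (p ++ v ++ q)) x -> c.
  move=> [[_ + Qx] cx]; rewrite -/m -/n (word_repl_cyl sv sp sq cx su) => au.
  split => //; first by rewrite -(wx _ _ sv cx); exact: coord_allowed.
  exists (repl (- N%:Z) u (coord x)) => //; exact: (word_repl_cyl sv sp sq cx su).
have sub b x : size b = (N + N)%N -> cyl m (p ++ b ++ q) x -> cyl (- N%:Z) b x.
  move=> sb; rewrite !cyl_cat => -[_ [+ _]].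
  by rewrite (_ : m + _ = - N%:Z) // /m sp; lia.
have [hc|hc] := pselect c; last first.
  rewrite (_ : B L `&` _ = set0); last by apply/seteqP; split=> // x /Bc.
  rewrite (_ : B' L `&` _ = set0); last by apply/seteqP; split=> // x /B'c.
  rewrite pr0 subrr normr0 divr_ge0 ?mulr_ge0 ?admissible_ge0 //.
    by rewrite exprn_ge0 // ltW.
  exact: ltW.
case: hc => au av [s ws Qs].
have -> : B L `&` cyl m (p ++ u ++ q) = cyl m (p ++ u ++ q).
  apply/seteqP; split=> [x []//|x cx]; split => //; split; first exact: sub cx.
    by rewrite -/m -/n (word_repl_cyl su sp sq cx sv).
  by apply: dK Qs; rewrite ws (wx _ _ su cx).
have -> : B' L `&` cyl m (p ++ v ++ q) = cyl m (p ++ v ++ q).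
  apply/seteqP; split=> [x []//|x cx]; split => //; split; first exact: sub cx.
    by rewrite -/m -/n (word_repl_cyl sv sp sq cx su).
  by apply: dK Qs; rewrite ws; apply/esym/(word_repl_cyl sv sp sq cx su).
rewrite /m !pr_cyl_weight ?spb // -mulrBl normrM /admissible au av !mul1r.
rewrite (ger0_norm (x := (_ * _)^-1)) // invr_ge0 mulr_ge0 ?(ltW weight_nil_gt0) //.
by rewrite exprn_ge0 // ltW.
Qed.

(** The two masses are the limits of those of [B L] and [B' L], which differ by at most a multiple
    of [beta^L] divided by [beta^(2 (N + L))]. *)
Lemma pr_swap_determined :
  pr mu [set x | [/\ cyl (- N%:Z) u x, substable (- N%:Z) v x & Q (coord x)]] =
  pr mu [set x | [/\ cyl (- N%:Z) v x, substable (- N%:Z) u x &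
                     Q (repl (- N%:Z) u (coord x))]].
Proof.
have capB : \bigcap_L B L =
    [set x | [/\ cyl (- N%:Z) u x, substable (- N%:Z) v x & Q (coord x)]].
  apply/seteqP; split=> x h.
    have [hu _ hQ] := h 0%N Logic.I; split=> //; apply: (allowedP beta_gt1) => j.
    have [_ hj _] := h j Logic.I; exists (- (N + j)%N%:Z), ((N + j) + (N + j))%N.
    by split => //; lia.
  by case: h => ? sx ? L _; split => //; exact: sx.
have capB' : \bigcap_L B' L = [set x | [/\ cyl (- N%:Z) v x, substable (- N%:Z) u x &
                     Q (repl (- N%:Z) u (coord x))]].
  apply/seteqP; split=> x h.
    have [hu _ hQ] := h 0%N Logic.I; split=> //; apply: (allowedP beta_gt1) => j.
    have [_ hj _] := h j Logic.I; exists (- (N + j)%N%:Z), ((N + j) + (N + j))%N.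
    by split => //; lia.
  by case: h => ? sx ? L _; split => //; exact: sx.
have sub L L' s : (L <= L')%N ->
    0 < state 1 (word (- (N + L')%N%:Z) ((N + L') + (N + L')) s) ->
    0 < state 1 (word (- (N + L)%N%:Z) ((N + L) + (N + L)) s).
  move=> LL'; have [||k ->] := @word_in (- (N + L)%N%:Z) ((N + L) + (N + L)) s
    (- (N + L')%N%:Z) ((N + L') + (N + L')); [lia|lia|].
  by move/state_gt0_suffix => /(_ beta_gt1 (lexx 1)) /state_gt0_prefix; apply.
have cB : pr mu (B L) @[L --> \oo] --> pr mu (\bigcap_L B L).
  apply: pr_nonincreasing_cvg => // n m nm x [h1 h2 h3]; split => //; exact: sub h2.
have cB' : pr mu (B' L) @[L --> \oo] --> pr mu (\bigcap_L B' L).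
  apply: pr_nonincreasing_cvg => // n m nm x [h1 h2 h3]; split => //; exact: sub h2.
rewrite -capB -capB'; apply/eqP; rewrite -subr_eq0 -normr_eq0; apply/eqP/le_anti.
rewrite normr_ge0 andbT.
have cD : `|pr mu (B L) - pr mu (B' L)| @[L --> \oo] -->
    `|pr mu (\bigcap_L B L) - pr mu (\bigcap_L B' L)|.
  by apply: cvg_norm; exact: cvgB.
have [C [C0 hC]] := nadm_upper beta_gt1.
pose D := beta / (beta - 1) * (3 * C) / (beta ^+ (N + N) * weight [::]).
have cE : D * beta^-1 ^+ L @[L --> \oo] --> (0 : R^o).
  apply: (@cvg_geometric _ D).
  by rewrite ger0_norm ?invr_ge0 ?(ltW beta_gt0) // invf_lt1.
apply: (ler_cvg_to cD cE); exists K0 => // L /= K0L.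
apply: le_trans (pr_diff_le (leq_trans K0L (leq_addl _ _))) _.
have pos k : 0 < beta ^+ k by rewrite exprn_gt0.
rewrite -(@ler_pM2r _ (beta ^+ ((N + L) + (N + L)) * weight [::])) ?mulr_gt0 //.
under eq_bigr do rewrite -mulr_suml.
rewrite -mulr_suml divfK; last by rewrite gt_eqF // mulr_gt0.
apply: le_trans (sum_weight_swap_le beta_gt1 _ _ _) _.
have -> : D * beta^-1 ^+ L * (beta ^+ ((N + L) + (N + L)) * weight [::]) =
    beta / (beta - 1) * (3 * (C * beta ^+ L)).
  rewrite /D exprVn !exprD; field; rewrite subr_eq0 !gt_eqF //.
rewrite ler_wpM2l ?divr_ge0 ?subr_ge0 ?(ltW beta_gt1) ?(ltW beta_gt0) //.
rewrite ler_wpM2l // -[beta ^+ L]mulr1; apply: hC; first by rewrite ler01 lexx.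
by rewrite mulr1 exprn_ege1 // ltW.
Qed.

End approximation.

Let D := cyl (- N%:Z) u `&` substable (- N%:Z) v.
Let D' := cyl (- N%:Z) v `&` substable (- N%:Z) u.
Let phi := subst (- N%:Z) u.

Let mD : measurable D.
Proof. by apply: measurableI; [exact: measurable_cyl|exact: measurable_substable]. Qed.

Let mD' : measurable D'.
Proof. by apply: measurableI; [exact: measurable_cyl|exact: measurable_substable]. Qed.

Let mphi E : measurable E -> measurable (phi @^-1` E).
Proof. by move=> mE; rewrite -[_ @^-1` _]setTI; exact: measurable_subst. Qed.

(** Window sets are covered by [pr_swap_determined]; the equality passes to complements, since it
    holds for the whole space, and to countable disjoint unions. *)
Lemma pr_swap_preimage E : measurable E ->
  pr mu (D `&` E) = pr mu (D' `&` phi @^-1` E).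
Proof.
have hc C : csets C -> pr mu (D `&` C) = pr mu (D' `&` phi @^-1` C).
  move=> [K0 [P ->]].
  have := @pr_swap_determined K0 (fun s => P (word (- K0%:Z) (K0 + K0) s)).
  move=> /(_ (fun s s' e => ltac:(by rewrite e))) h.
  transitivity (pr mu [set x | [/\ cyl (- N%:Z) u x, substable (- N%:Z) v x &
      P (word (- K0%:Z) (K0 + K0) (coord x))]]).
    by congr pr; apply/seteqP; split=> x; [case=> -[]|case].
  rewrite h; congr pr; apply/seteqP; split=> x.
    by case=> h1 h2 h3; split => //; rewrite /cset /= coord_subst.
  by case=> -[h1 h2]; rewrite /cset /= coord_subst.
have hT : pr mu D = pr mu D'.
  by have := hc _ (@csetsT _ beta); rewrite preimage_setT !setIT.
move=> mE; move: (mE); rewrite [X in X E -> _]measurable_csets // => sE.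
have compl (A S : set X) : measurable A -> measurable S ->
    pr mu (A `&` ~` S) = pr mu A - pr mu (A `&` S).
  move=> mA mS; rewrite -prD //; last exact: measurableI.
  congr pr; apply/seteqP; split=> [x [Ax nS]|x [Ax nS]].
    by split=> // -[_ /nS].
  by split=> // Sx; apply: nS.
apply: (@dynkin_induction _ X (@csets R beta)
  (fun E => pr mu (D `&` E) = pr mu (D' `&` phi @^-1` E))) sE => //.
- exact: measurable_csets.
- exact: csetsI.
- by rewrite preimage_setT !setIT.
- move=> S mS hS; rewrite preimage_setC !compl //; last exact: mphi.
  by rewrite hT hS.
- move=> F mF tF hF; rewrite preimage_bigcup !setI_bigcupr.
  have c1 : \sum_(0 <= i < n) pr mu (D `&` F i) @[n --> \oo] -->
      pr mu (\bigcup_n (D `&` F n)).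
    apply: pr_sigma_additive => [n|]; first exact: measurableI.
    apply/trivIsetP => i j _ _ ij; move/trivIsetP : tF => /(_ i j Logic.I Logic.I ij) e.
    by rewrite setIACA e setI0.
  have c2 : \sum_(0 <= i < n) pr mu (D' `&` phi @^-1` F i) @[n --> \oo] -->
      pr mu (\bigcup_n (D' `&` phi @^-1` F n)).
    apply: pr_sigma_additive => [n|]; first by apply: measurableI => //; exact: mphi.
    apply/trivIsetP => i j _ _ ij; move/trivIsetP : tF => /(_ i j Logic.I Logic.I ij) e.
    apply/seteqP; split=> // x [[_ h1] [_ h2]].
    by have : (F i `&` F j) (phi x) by []; rewrite e.
  have e : (fun n => \sum_(0 <= i < n) pr mu (D `&` F i)) =
      (fun n => \sum_(0 <= i < n) pr mu (D' `&` phi @^-1` F i)).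
    by apply/funext => n; apply: eq_bigr => i _.
  by rewrite e in c1; exact: (cvg_unique _ c1 c2).
Qed.

Lemma pr_swap_image E : measurable E -> E `<=` D ->
  pr mu (subst (- N%:Z) v @` E) = pr mu E.
Proof.
move=> mE ED; rewrite (subst_image beta_gt1 _ ED) ?su ?sv //.
by rewrite -/D' -/phi -pr_swap_preimage // (setIidr ED).
Qed.

End swap.

Lemma gibbs_relation_repl (x y : X) : gibbs_relation x y -> exists N,
  coord y = repl (- N%:Z) (word (- N%:Z) (N + N) (coord y)) (coord x).
Proof.
(* The sum of [|k| + 1] over the places of difference exceeds each [|k|], so the window [[-N, N)]
   contains all of them. *)
move=> /finite_seqP[s hs]; exists (\sum_(k <- s) (absz k).+1)%N.
apply/funext => k; rewrite /repl size_word; case: ifP => h.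
  rewrite nth_word; last by lia.
  by congr (coord y _); lia.
apply: contrapT => ne; move/negbT: h; apply/negP; rewrite negbK.
have ks : [set` s] k by rewrite -hs /= => e; apply: ne; rewrite /coord e.
have : ((absz k).+1 <= \sum_(k <- s) (absz k).+1)%N.
  by rewrite (big_rem k) //= leq_addr.
by lia.
Qed.

(** Related points differ by the replacement of one centred window, so [A] is a countable union of
    sets on which [g] is such a replacement. Made disjoint, the pieces keep their mass by
    [pr_swap_image], and their images are disjoint because [g] is injective on [A]. *)
Lemma parry_gibbs_invariant : gibbs_invariant mu.
Proof.
move=> A B g [mA mB [fg ig sg] mg _] rel.
have gAB : g @` A = B by apply/seteqP; split=> // _ [x Ax <-]; exact: fg.
pose F (i : nat * (seq nat * seq nat)) : set X :=
  if (size i.2.1 == (i.1 + i.1)%N) && (size i.2.2 == (i.1 + i.1)%N) then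
    cyl (- i.1%:Z) i.2.1 `&` substable (- i.1%:Z) i.2.2 `&`
    [set x | A x /\ forall k, coord (g x) k = coord (subst (- i.1%:Z) i.2.2 x) k]
  else set0.
have mF i : measurable (F i).
  rewrite /F; case: ifP => // _; apply: measurableI.
    by apply: measurableI; [exact: measurable_cyl|exact: measurable_substable].
  (* Agreement of [g] with the replacement is tested at each coordinate [k] through the common digit
     [a], which makes it a countable combination of measurable sets. *)
  rewrite (_ : [set _ | _] = [set x | forall k : int,
     (\bigcup_a (A `&` g @^-1` [set y | coord y k = a] `&`
       subst (- i.1%:Z) i.2.2 @^-1` [set y | coord y k = a])) x]).
    apply: (@measurable_forall _ _ _ (fun k : int =>
      \bigcup_a (A `&` g @^-1` [set y | coord y k = a] `&`
       subst (- i.1%:Z) i.2.2 @^-1` [set y | coord y k = a]))) => k.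
    apply: bigcupT_measurable => a; apply: measurableI.
      by apply: mg => //; exact: measurable_coord.
    rewrite -[_ @^-1` _]setTI; apply: measurable_subst => //; exact: measurable_coord.
  apply/seteqP; split=> x /=.
    by move=> [Ax h] k; exists (coord (g x) k) => //=; rewrite -h.
  move=> h; split; first by have [a _ [[]]] := h 0.
  by move=> k; have [a _ [[_ /= ->] /= ->]] := h k.
(* The triples of a radius and two words are enumerated; numbers that code none give the empty
   set. *)
pose E' n : set X := if unpickle n is Some i then F i else set0.
pose E := seqDU E'.
have mE' n : measurable (E' n) by rewrite /E'; case: unpickle.
have mE n : measurable (E n) by exact: seqDU_measurable.
have tE : trivIset setT E by exact: trivIset_seqDU.
have UE : \bigcup_n E n = A.
  rewrite -seqDU_bigcup_eq; apply/seteqP; split=> x.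
    move=> [n _]; rewrite /E'; case: unpickle => // i; rewrite /F; case: ifP => // _.
    by case=> _ [].
  move=> Ax; have [N hN] := gibbs_relation_repl (rel x Ax).
  exists (pickle (N, (word (- N%:Z) (N + N) (coord x), word (- N%:Z) (N + N) (coord (g x))))) => //.
  rewrite /E' pickleK /F !size_word eqxx /=.
  have sx : substable (- N%:Z) (word (- N%:Z) (N + N) (coord (g x))) x.
    by rewrite /substable /= -hN; exact: coord_allowed.
  split; first by split; rewrite // /cyl /= size_word.
  by split => // k; rewrite coord_subst // -hN.
have EA n : E n `<=` A by move=> x En; rewrite -UE; exists n.
have Eg n : pr mu (g @` E n) = pr mu (E n) /\ measurable (g @` E n).
  have := @subset_seqDU _ E' n; rewrite -/(E n) /E'.
  case: unpickle => [[N [u v]]|E0]; last first.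
    by have -> : E n = set0; [rewrite -subset0|rewrite image_set0].
  rewrite /F /=; case: ifP => [/andP[/eqP su /eqP sv] sE|_ E0]; last first.
    by have -> : E n = set0; [rewrite -subset0|rewrite image_set0].
  have -> : g @` E n = subst (- N%:Z) v @` E n.
    apply/seteqP; split=> _ [x Ex <-]; have [_ [_ h]] := sE _ Ex; exists x => //;
      by apply: coord_inj; apply/funext => k; rewrite h.
  have sE' : E n `<=` cyl (- N%:Z) u `&` substable (- N%:Z) v by move=> x /sE [].
  split; first exact: pr_swap_image su sv _ (mE n) sE'.
  by apply: (measurable_subst_image beta_gt1 _ (mE n) sE'); rewrite su sv.
have gU : g @` A = \bigcup_n (g @` E n) by rewrite -UE image_bigcup.
have c1 : \sum_(0 <= i < n) pr mu (E i) @[n --> \oo] --> pr mu A.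
  by rewrite -UE; exact: pr_sigma_additive.
have c2 : \sum_(0 <= i < n) pr mu (g @` E i) @[n --> \oo] --> pr mu (g @` A).
  rewrite gU; apply: pr_sigma_additive => [n|]; first exact: (Eg n).2.
  apply/trivIsetP => i j _ _ ij; move/trivIsetP : tE => /(_ i j Logic.I Logic.I ij) e.
  apply/seteqP; split=> // y [[x1 h1 <-] [x2 h2 /ig e2]].
  have x21 : x2 = x1 by apply: e2; rewrite inE; [exact: EA h2|exact: EA h1].
  have : (E i `&` E j) x1 by split => //; rewrite -x21.
  by rewrite e.
rewrite -!prE // ?gAB //; congr EFin; rewrite -gAB.
have e : (fun n => \sum_(0 <= i < n) pr mu (g @` E i)) =
    (fun n => \sum_(0 <= i < n) pr mu (E i)).
  by apply/funext => n; apply: eq_bigr => i _; exact: (Eg i).1.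
by rewrite e in c2; exact: (cvg_unique _ c2 c1).
Qed.

End invariance.

(* Equality of measures is equality on measurable sets: the library's measures *)
(* are total functions on all sets, unconstrained off the sigma-algebra.       *)
Theorem theorem5p1 (R : realType) (beta : R) (hbeta : 1 < beta) :
  exists mu : probability (beta_shift_borel beta) R,
    gibbs_invariant mu /\
    forall nu : probability (beta_shift_borel beta) R, gibbs_invariant nu ->
      forall A : set (beta_shift_borel beta), measurable A -> nu A = mu A.
Proof.
have [mu mu_cyl] := parry_measure hbeta.
have gmu := parry_gibbs_invariant hbeta mu_cyl.
by exists mu; split=> // nu gnu A mA; exact: gibbs_unique.
Qed.
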